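(* Let $n\ge2$, $k\ge1$, let $M^n\hookrightarrow\tilde M^{n+k}$ be an embedded submanifold of a Riemannian manifold, $v$ a vector field on $M$, $p\in M$, with $v$ extended to a neighborhood of $p$ in $\tilde M$ (still denoted $v$). Suppose $v$ is divergence free both on $M$ and on $\tilde M$. Then $-2\,\widetilde{\operatorname{div}}\,\widetilde{\operatorname{Def}}\,v=\tilde\nabla^*\tilde\nabla v-\widetilde{\mathrm{Ric}}\,v$ and $-2\operatorname{div}\operatorname{Def}v=\nabla^*\nabla v-\mathrm{Ric}\,v$, and on $M$ (at $p$) $$\begin{aligned}\tilde\nabla^*\tilde\nabla v-\widetilde{\mathrm{Ric}}\,v&=\nabla^*\nabla v-\mathrm{Ric}\,v+n[\mathbf H,v]-\sum_{l=1}^k\tilde\nabla_{N_l}\tilde\nabla_{N_l}v+\sum_{l=1}^k\tilde\nabla_{\tilde\nabla_{N_l}N_l}v-\sum_{l=1}^k\delta^{ij}\tilde R(N_l,E_i,v,N_l)E_j\\&\quad-2\delta^{ij}\mathrm{II}(E_i,\nabla_{E_j}v)-\delta^{ij}(\tilde R(E_j,v)E_i)^\perp-(\widetilde{\mathrm{Ric}}\,v)^\perp,\end{aligned}$$ or equivalently $$\begin{aligned}\tilde\nabla^*\tilde\nabla v-\widetilde{\mathrm{Ric}}\,v&=\nabla^*\nabla v-\mathrm{Ric}\,v+nW_{\mathbf H}v+n\tilde\nabla_{\mathbf H}v-\sum_{l=1}^k\tilde\nabla_{N_l}\tilde\nabla_{N_l}v+\sum_{l=1}^k\tilde\nabla_{\tilde\nabla_{N_l}N_l}v-\sum_{l=1}^k\delta^{ij}\tilde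 R(N_l,E_i,v,N_l)E_j\\&\quad-(\operatorname{tr}\nabla^B\mathrm{II})(v)-2\delta^{ij}\mathrm{II}(E_i,\nabla_{E_j}v)-(\widetilde{\mathrm{Ric}}\,v)^\perp.\end{aligned}$$ In particular, for $M\hookrightarrow\mathbb R^{n+k}$ there are the two equivalent formulas $$\tilde\nabla^*\tilde\nabla v=\nabla^*\nabla v-\mathrm{Ric}\,v+n[\mathbf H,v]-\sum_{l=1}^k\tilde\nabla_{N_l}\tilde\nabla_{N_l}v+\sum_{l=1}^k\tilde\nabla_{\tilde\nabla_{N_l}N_l}v-2\delta^{ij}\mathrm{II}(E_i,\nabla_{E_j}v),$$ $$\tilde\nabla^*\tilde\nabla v=\nabla^*\nabla v-\mathrm{Ric}\,v+nW_{\mathbf H}v+n\tilde\nabla_{\mathbf H}v-\sum_{l=1}^k\tilde\nabla_{N_l}\tilde\nabla_{N_l}v+\sum_{l=1}^k\tilde\nabla_{\tilde\nabla_{N_l}N_l}v-(\operatorname{tr}\nabla^B\mathrm{II})(v)-2\delta^{ij}\mathrm{II}(E_i,\nabla_{E_j}v).$$ In the case of a hypersurface $M^n\hookrightarrow\tilde M^{n+1}$, $$\tilde\nabla^*\tilde\nabla v-\widetilde{\mathrm{Ric}}\,v=\nabla^*\nabla v-\mathrm{Ric}\,v+nH[N,v]^T-\tilde\nabla_N\tilde\nabla_Nv+\nabla_{\tilde\nabla_NN}v+\mathcal E_2(v)+\mathcal N_4(v),$$ where $\mathcal E_2(v)=-\delta^{ij}\tilde R(N,E_i,v,N)E_j$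 and $$\begin{aligned}\mathcal N_4(v)&=-\Big(2\sum_i\kappa_i\nabla_iv^i+nv(H)\Big)N+h(\tilde\nabla_NN,v)N\\&=-\Big(2\sum_i\kappa_i\nabla_iv^i+(\operatorname{div}h)(v)\Big)N-(\widetilde{\mathrm{Ric}}\,v)^\perp+h(\tilde\nabla_NN,v)N.\end{aligned}$$ Hence for a hypersurface $M^n\hookrightarrow\mathbb R^{n+1}$, $$\tilde\nabla^*\tilde\nabla v=\nabla^*\nabla v-\mathrm{Ric}\,v+nH[N,v]^T-\tilde\nabla_N\tilde\nabla_Nv+\nabla_{\tilde\nabla_NN}v+\mathcal N_4(v).$$
   Context: Everything is smooth. $M$ carries the induced metric $g$; $\tilde\nabla,\nabla$ are the Levi-Civita connections of $(\tilde M,\tilde g)$ and $(M,g)$. ${}^T,{}^\perp$ are orthogonal projections onto $T_pM$ and $(T_pM)^\perp$. ''Divergence free on $\tilde M$'' means on the neighborhood of $p$ where the extension is defined; on $M$ it refers to the intrinsic divergence of $v|_M$. Frames: $E_1,\dots,E_n$ is a local orthonormal (ON) frame on $M$ near $p$, $N_1,\dots,N_k$ a local ON frame of the normal bundle, extended so that together they form an ON frame of $\tilde M$ in a neighborhood of $p$. For $k=1$, $N=N_1$ is a choice of unit normal and the $E_i$ at $p$ are eigenvectors of the shape operator. Indices $i,j$ run over $1,\dots,n$; repeated indices are summed. $\mathrm{II}(X,Y)=(\tilde\nabla_XY)^\perp$; for a normal field $\eta$, $g(W_\eta X,Y)=\tilde g(\eta,\mathrm{II}(X,Y))$, i.e.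 $W_\eta X=-(\tilde\nabla_X\eta)^T$; $\mathbf H=\frac1n\delta^{ij}\mathrm{II}(E_i,E_j)$ (extended to a neighborhood of $p$ in $[\mathbf H,v]$); $\nabla^\perp_X\eta=(\tilde\nabla_X\eta)^\perp$; $(\nabla^B_XA)(Y,Z)=\nabla^\perp_X(A(Y,Z))-A(\nabla_XY,Z)-A(Y,\nabla_XZ)$ for normal-bundle-valued bilinear maps $A$ on $TM$; $(\operatorname{tr}\nabla^B\mathrm{II})(v)=\delta^{ij}(\nabla^B_{E_i}\mathrm{II})(E_j,v)$. For $k=1$: $h(X,Y)=\tilde g(N,\mathrm{II}(X,Y))$; $g(sX,Y)=h(X,Y)$, so $sX=-\tilde\nabla_XN$; $sE_i=\kappa_iE_i$ at $p$; $H=\frac1n\sum_i\kappa_i$, $\mathbf H=HN$; $(\operatorname{div}h)(v)=\sum_i(\nabla_{E_i}h)(E_i,v)$. $\nabla_iv^j=E_i(v^j)+\Gamma^j_{ik}v^k$ with $\nabla_{E_i}E_k=\Gamma_{ik}^jE_j$; in $\sum_i\kappa_i\nabla_iv^i$, $\nabla_iv^i=g(\nabla_{E_i}v,E_i)$. Divergence $\operatorname{div}v=\nabla_iv^i$. Deformation tensor: $(\operatorname{Def}v)_{ij}=\frac12(\nabla_iv_j+\nabla_jv_i)$; $\operatorname{div}\operatorname{Def}v$ has components $\nabla^i(\operatorname{Def}v)_{ij}$ (index raised to get a vector field); tildes denote the operators of $\tilde M$. Bochner Laplacian for a Levi-Civita connection $D$ and ON frame $\{F_a\}$: $D^*Dv=-\sum_a(D_{F_a}D_{F_a}v-D_{D_{F_a}F_a}v)$.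 Curvature convention (tilde for $\tilde M$): $R(X,Y)Z=\nabla_X\nabla_YZ-\nabla_Y\nabla_XZ-\nabla_{[X,Y]}Z$, $R(W,X,Y,Z)=g(R(W,X)Y,Z)$, $\mathrm{Ric}(X,Y)=\sum_aR(F_a,X,Y,F_a)$ over an ON frame, $\mathrm{Ric}\,v=\mathrm{Ric}(v,\cdot)^\sharp$. *)

(* Defs.v *)
From HB Require Import structures.
From mathcomp Require Import all_boot all_order all_algebra.
From mathcomp Require Import all_classical all_reals all_analysis.
Set Implicit Arguments.
Unset Strict Implicit.
Unset Printing Implicit Defensive.
Import Order.TTheory GRing.Theory Num.Theory.
Import numFieldNormedType.Exports.
Local Open Scope classical_set_scope.
Local Open Scope ring_scope.

(* Functions and fields that are only meaningful on an open set are total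
   functions throughout; the predicates only look at them near a point. *)

Record chart (R : realType) (m : nat) (T : topologicalType) := Chart {
  dom : set T;
  ccoord : T -> 'rV[R]_m;
  param : 'rV[R]_m -> T }.

(* The data of a Riemannian manifold; the axioms are [smooth_manifold] and
   [riemannian_metric]. Tangent vectors at a point are derivations of germs
   of smooth functions, hence elements of [(T -> R) -> R]. *)
Record riem (R : realType) (m : nat) := Riem {
  carrier :> topologicalType;
  atlas : set (chart R m carrier);
  metric : carrier -> ((carrier -> R) -> R^o) -> ((carrier -> R) -> R^o) -> R }.

(* Iterated directional derivatives. A function on an open subset of R^m is
   C^oo iff all of them are differentiable there. *)
Definition iterD (R : realType) (m : nat) (vs : seq 'rV[R]_m)
    (f : 'rV[R]_m -> R) : 'rV[R]_m -> R :=
  foldr (fun v g => 'D_v g) f vs.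

Record smooth_manifold (R : realType) (m : nat) (M : riem R m) : Prop := {
  mfd_hausdorff : hausdorff_space M;
  mfd_second_countable : @second_countable M;
  mfd_cover : forall p : M, exists2 c, atlas c & dom c p;
  mfd_open : forall c : chart R m M, atlas c ->
    open (dom c) /\ open (ccoord c @` dom c);
  mfd_homeo : forall c : chart R m M, atlas c -> forall p, dom c p ->
    [/\ param c (ccoord c p) = p,
        {for p, continuous (ccoord c)} &
        {for ccoord c p, continuous (param c)}];
  mfd_compatible : forall c d : chart R m M, atlas c -> atlas d ->
    forall p, dom c p -> dom d p -> forall (j : 'I_m) (vs : seq 'rV[R]_m),
    differentiable (iterD vs (fun y => ccoord d (param c y) ord0 j))
                   (ccoord c p) }.

Section Manifold.
Context {R : realType} {m : nat} {M : riem R m}.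

Definition vec := (M -> R) -> R^o.
Definition vfield := M -> vec.

(* [f] is smooth on a neighbourhood of [p]. *)
Definition smooth (f : M -> R) (p : M) : Prop :=
  \forall q \near p, forall c : chart R m M, atlas c -> dom c q ->
    forall vs, differentiable (iterD vs (f \o param c)) (ccoord c q).

(* [tangent_zero] fixes the value on functions that are not smooth near the
   point, so that tangent vectors are equal iff they are equal as derivations. *)
Record tangent (p : M) (u : vec) : Prop := {
  tangent_germ : forall f g, smooth f p -> smooth g p ->
    (\forall q \near p, f q = g q) -> u f = u g;
  tangent_linear : forall (a : R) f g, smooth f p -> smooth g p ->
    u (fun q => a * f q + g q) = a * u f + u g;
  tangent_leibniz : forall f g, smooth f p -> smooth g p ->
    u (fun q => f q * g q) = f p * u g + g p * u f;
  tangent_zero : forall f, ~ smooth f p -> u f = 0 }.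

(* [X] is a smooth vector field on a neighbourhood of [p]. *)
Definition smooth_field (X : vfield) (p : M) : Prop :=
  \forall q \near p, tangent q (X q) /\
    forall f, smooth f q -> smooth (fun r => X r f) q.

Record riemannian_metric : Prop := {
  metric_linear : forall (p : M) (a : R) (u v w : vec),
    tangent p u -> tangent p v -> tangent p w ->
    metric p (a *: u + v) w = a * metric p u w + metric p v w;
  metric_sym : forall (p : M) (u w : vec),
    tangent p u -> tangent p w -> metric p u w = metric p w u;
  metric_pos : forall (p : M) (u : vec),
    tangent p u -> u != 0 -> 0 < metric p u u;
  metric_smooth : forall (p : M) (X Y : vfield),
    smooth_field X p -> smooth_field Y p ->
    smooth (fun q => metric q (X q) (Y q)) p }.

Definition lie (X Y : vfield) : vfield := fun p f =>
  if `[< smooth f p >] then X p (fun q => Y q f) - Y p (fun q => X q f) else 0.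

(* [D X Y] is nabla_X Y; the axioms hold at every point, for fields that are
   defined and smooth near that point. *)
Record levi_civita (D : vfield -> vfield -> vfield) : Prop := {
  lc_smooth : forall p X Y, smooth_field X p -> smooth_field Y p ->
    smooth_field (D X Y) p;
  lc_local : forall p X X' Y Y', smooth_field X p -> smooth_field X' p ->
    smooth_field Y p -> smooth_field Y' p ->
    (\forall q \near p, X q = X' q) -> (\forall q \near p, Y q = Y' q) ->
    D X Y p = D X' Y' p;
  lc_linear_l : forall p f X X' Y, smooth f p -> smooth_field X p ->
    smooth_field X' p -> smooth_field Y p ->
    D (fun q => f q *: X q + X' q) Y p = f p *: D X Y p + D X' Y p;
  lc_add_r : forall p X Y Y', smooth_field X p -> smooth_field Y p ->
    smooth_field Y' p ->
    D X (fun q => Y q + Y' q) p = D X Y p + D X Y' p;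
  lc_leibniz : forall p f X Y, smooth f p -> smooth_field X p ->
    smooth_field Y p ->
    D X (fun q => f q *: Y q) p = X p f *: Y p + f p *: D X Y p;
  lc_torsion_free : forall p X Y, smooth_field X p -> smooth_field Y p ->
    D X Y p - D Y X p = lie X Y p;
  lc_metric : forall p X Y Z, smooth_field X p -> smooth_field Y p ->
    smooth_field Z p ->
    X p (fun q => metric q (Y q) (Z q)) =
    metric p (D X Y p) (Z p) + metric p (Y p) (D X Z p) }.

Definition on_frame (I : finType) (F : I -> vfield) (p : M) : Prop :=
  (forall a, smooth_field (F a) p) /\
  \forall q \near p,
    (forall a b, metric q (F a q) (F b q) = (a == b)%:R) /\
    (forall u, tangent q u -> exists c : I -> R, u = \sum_a c a *: F a q).

(* [F] is an orthonormal frame near the point of evaluation. *)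
Section Operators.
Variables (D : vfield -> vfield -> vfield) (I : finType) (F : I -> vfield).

Definition curv (X Y Z : vfield) : vfield := fun p =>
  D X (D Y Z) p - D Y (D X Z) p - D (lie X Y) Z p.
Definition curv4 (W X Y Z : vfield) (p : M) : R :=
  metric p (curv W X Y p) (Z p).
Definition ric (X Y : vfield) (p : M) : R := \sum_a curv4 (F a) X Y (F a) p.
Definition ric_op (v : vfield) : vfield := fun p =>
  \sum_a ric v (F a) p *: F a p.

Definition divergence (v : vfield) (p : M) : R :=
  \sum_a metric p (D (F a) v p) (F a p).

Definition def_tensor (v X Y : vfield) (p : M) : R :=
  2^-1 * (metric p (D X v p) (Y p) + metric p (D Y v p) (X p)).

Definition nabla2 (B : vfield -> vfield -> M -> R) (Z X Y : vfield) (p : M) : R :=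
  Z p (B X Y) - B (D Z X) Y p - B X (D Z Y) p.

Definition div_def (v : vfield) : vfield := fun p =>
  \sum_b (\sum_a nabla2 (def_tensor v) (F a) (F a) (F b) p) *: F b p.

Definition bochner (v : vfield) : vfield := fun p =>
  - \sum_a (D (F a) (D (F a) v) p - D (D (F a) (F a)) v p).

End Operators.
End Manifold.

Arguments vec {R m} M.
Arguments vfield {R m} M.
Arguments riemannian_metric {R m} M.

Definition euclidean (R : realType) (m : nat) : riem R m :=
  @Riem R m 'rV[R]_m
    [set Chart setT (fun x => x) (fun x => x)]
    (fun _ u w => \sum_(i < m) u (fun x => x ord0 i) * w (fun x => x ord0 i)).

Section Submanifold.
Context {R : realType} {n m : nat} {Mt : riem R m} {M : riem R n}.
Variable iota : M -> Mt.

(* The differential of [iota] at [q], normalised as in [tangent_zero]. *)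
Definition push (q : M) (u : vec M) : vec Mt := fun f =>
  if `[< smooth f (iota q) >] then u (f \o iota) else 0.
Definition pushf (X : vfield M) : M -> vec Mt := fun q => push q (X q).

(* [iota] is a smooth embedding and [M] carries the induced metric. *)
Record riemannian_embedding : Prop := {
  emb_continuous : continuous iota;
  emb_smooth : forall q f, smooth f (iota q) -> smooth (f \o iota) q;
  emb_injective : injective iota;
  emb_homeo : forall U : set M, open U ->
    exists2 V : set Mt, open V & U = iota @^-1` V;
  emb_immersion : forall q u, tangent q u -> push q u = 0 -> u = 0;
  emb_induced_metric : forall q u w, tangent q u -> tangent q w ->
    metric q u w = metric (iota q) (push q u) (push q w) }.

(* [Yt] extends the field [Y] along [M] to a neighbourhood of [iota q]. *)
Definition extends (Y : M -> vec Mt) (Yt : vfield Mt) (q : M) : Prop :=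
  smooth_field Yt (iota q) /\ \forall r \near q, Yt (iota r) = Y r.

(* Orthogonal projection of T_(iota q) Mt onto T_q M, as a vector of [M]. *)
Definition tpart (q : M) (w : vec Mt) : vec M :=
  xget 0 [set u | tangent q u /\ forall u', tangent q u' ->
    metric (iota q) (push q u) (push q u') = metric (iota q) w (push q u')].
Definition npart (q : M) (w : vec Mt) : vec Mt := w - push q (tpart q w).

Variables (Dt : vfield Mt -> vfield Mt -> vfield Mt).
Variables (D : vfield M -> vfield M -> vfield M).

(* Ambient derivative of a field along [M] in a direction tangent to [M],
   computed with arbitrary extensions (it does not depend on them). *)
Definition dalong (X : vfield M) (Y : M -> vec Mt) (q : M) : vec Mt :=
  xget 0 [set w | exists Xt Yt, [/\ extends (pushf X) Xt q,
    extends Y Yt q & w = Dt Xt Yt (iota q)]].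

Definition second_form (X Y : vfield M) (q : M) : vec Mt :=
  npart q (dalong X (pushf Y) q).

Definition weingarten (eta : M -> vec Mt) (X : vfield M) : vfield M := fun q =>
  - tpart q (dalong X eta q).

Definition nconn (X : vfield M) (eta : M -> vec Mt) (q : M) : vec Mt :=
  npart q (dalong X eta q).

Definition nablaB (A : vfield M -> vfield M -> M -> vec Mt) (X Y Z : vfield M)
    (q : M) : vec Mt :=
  nconn X (A Y Z) q - A (D X Y) Z q - A Y (D X Z) q.

Definition mean_curv_vec (E : 'I_n -> vfield M) (q : M) : vec Mt :=
  n%:R^-1 *: \sum_i second_form (E i) (E i) q.

Definition tr_nablaB_II (E : 'I_n -> vfield M) (v : vfield M) (q : M) : vec Mt :=
  \sum_i nablaB second_form (E i) (E i) v q.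

(* From here to the end of the section [Mt] has dimension [n + 1] and [N] is a
   unit field that is normal along [M]. *)

Definition sff (N : vfield Mt) (X Y : vfield M) (q : M) : R :=
  metric (iota q) (N (iota q)) (second_form X Y q).

Definition shape_op (N : vfield Mt) (X : vfield M) : vfield M :=
  weingarten (N \o iota) X.

(* The mean of the principal curvatures, i.e. of the eigenvalues of [shape_op]:
   a trace, so that no eigenbasis is needed away from the base point. *)
Definition mean_curv (E : 'I_n -> vfield M) (N : vfield Mt) (q : M) : R :=
  n%:R^-1 * \sum_i metric q (shape_op N (E i) q) (E i q).

Definition div_sff (E : 'I_n -> vfield M) (N : vfield Mt) (v : vfield M)
    (q : M) : R :=
  \sum_i nabla2 D (sff N) (E i) (E i) v q.

End Submanifold.

Definition join_frame (R : realType) (m n k : nat) (Mt : riem R m)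
    (Et : 'I_n -> vfield Mt) (N : 'I_k -> vfield Mt) (a : 'I_n + 'I_k) :
    vfield Mt :=
  match a with inl i => Et i | inr l => N l end.

(* [v] is only required to be divergence free near the base point. *)
Record setting (R : realType) (n k : nat) (Mt : riem R (n + k)) (M : riem R n)
    (iota : M -> Mt) (Dt : vfield Mt -> vfield Mt -> vfield Mt)
    (D : vfield M -> vfield M -> vfield M) (p : M)
    (E : 'I_n -> vfield M) (Et : 'I_n -> vfield Mt) (N : 'I_k -> vfield Mt)
    (v : vfield M) (vt : vfield Mt) : Prop := {
  set_manifold : smooth_manifold M;
  set_metric : riemannian_metric M;
  set_embedding : riemannian_embedding iota;
  set_ambient_lc : levi_civita Dt;
  set_lc : levi_civita D;
  set_frame : on_frame E p;
  set_frame_ext : forall i, extends iota (pushf iota (E i)) (Et i) p;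
  set_normal : forall l, \forall q \near p, forall u, tangent q u ->
    metric (iota q) (N l (iota q)) (push iota q u) = 0;
  set_ambient_frame : on_frame (join_frame Et N) (iota p);
  set_field : forall q, smooth_field v q;
  set_field_ext : extends iota (pushf iota v) vt p;
  set_div : \forall q \near p, divergence D E v q = 0;
  set_ambient_div : \forall x \near iota p,
    divergence Dt (join_frame Et N) vt x = 0 }.

(* Main.v *)
Require Import Defs.
From HB Require Import structures.
From mathcomp Require Import all_boot all_order all_algebra.
From mathcomp Require Import all_classical all_reals all_analysis.
From mathcomp Require Import ring lra.
Import Order.TTheory GRing.Theory Num.Theory.
Import numFieldNormedType.Exports.
Local Open Scope classical_set_scope.
Local Open Scope ring_scope.

(**
  Near the point, every object of the submanifold is expressed by ambient
  fields. The frame (Et, N) yields the projections [tproj] and [nproj] of ambient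
  fields, and the Koszul formula, in which only metric and brackets occur, shows
  that the connection of M is the tangential projection of the ambient one
  ([gauss_formula]). As the projected derivative is again an ambient field, the
  fields D_{E_j} v, the second fundamental form and the mean curvature vector all
  have explicit extensions; a derivative tangent to M depends only on values
  along M ([conn_along]), so any other extension gives the same result.

  With these translations the comparison is a computation at one point. In
  D_{E_j} D_{E_j} v - D_{D_{E_j} E_j} v each ambient derivative is split into a
  tangential and a normal part. The tangential-tangential terms form the
  Laplacian of M, the normal terms form the trace of the derivative of II and
  twice II(E_j, D_{E_j} v), and the normal part of D_{E_j} E_j produces the
  derivative along the mean curvature vector H. There remain the tangential
  derivatives of the normal fields II(E_j, v): by the contracted Gauss equation
  ([tangential_ricci]) they account for the difference between the two Ricci
  terms, for the Weingarten term of H and for the curvature in the normal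
  directions. This proves [laplacian_weingarten]; the contracted Codazzi equation
  ([tr_nablaB_codazzi]) turns it into the version with [H, v] ([laplacian_lie]).

  For a hypersurface H is replaced by the mean curvature times N. Both fields
  being divergence free makes [N, v] tangent to M ([lie_normal_tangential]), D_N N
  is tangent because N has constant length, and the normal curvature terms cancel
  by skew symmetry. The two forms of the normal term differ by the Codazzi
  equation contracted once more ([mean_codazzi]).

  The identities for -2 div Def are the commutation of two covariant derivatives
  ([weitzenbock]). In Euclidean space a connection acts on coordinates by
  differentiation, again by the Koszul formula, so the curvature vanishes
  ([euclidean_flat]).
*)

Set Implicit Arguments.
Unset Strict Implicit.
Unset Printing Implicit Defensive.

Local Notation iterD := Defs.iterD.

(** * Iterated directional derivatives *)

Section IteratedDerivatives.
Context {R : realType} {m : nat}.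
Implicit Types (f g : 'rV[R]_m -> R) (O : set 'rV[R]_m).

(** The order is bounded because the Leibniz rule is proved by induction on
    it: differentiating a product k + 1 times requires k derivatives of
    products in which one factor has not been differentiated. *)
Definition diff_upto (k : nat) O f :=
  forall vs y, (size vs <= k)%N -> O y -> differentiable (iterD vs f) y.

Lemma iterD_eq O f g : open O -> (forall y, O y -> f y = g y) ->
  forall vs y, O y -> iterD vs f y = iterD vs g y.
Proof.
move=> oO fg; elim=> [|v vs IH] y Oy /=; first exact: fg.
apply: near_eq_derive; near=> z; apply: IH; near: z.
by apply: open_nbhs_nbhs; split.
Unshelve. all: by end_near. Qed.

(** The difference of the two functions vanishes near y, so it is a little o of
    every function, with differential 0. *)
Lemma near_eq_differentiable f g y : (\near y, f y = g y) ->
  differentiable f y -> differentiable g y.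
Proof.
move=> fg df.
(* The affine approximation with zero linear part is exact near y. *)
have h0 : (g - f) \o shift y = cst ((g - f) y) + (\0 : 'rV[R]_m -> R) +o_ 0 id.
  apply/eqaddoP => _/posnumP[e].
  near=> z; rewrite !fctE /= (nbhs_singleton fg) subrr addr0 subr0.
  suff -> : f (z + y) = g (z + y) by rewrite subrr normr0 mulr_ge0.
  near: z; have := fg; rewrite (near_shift 0) /=.
  by apply: filterS => z; rewrite subr0.
have d0 : differentiable (g - f) y.
  apply/diff_locallyP.
  have -> : 'd (g - f) y = (\0 : 'rV[R]_m -> R) :> ('rV[R]_m -> R).
    by apply: diff_unique h0; exact: cst_continuous.
  by split => //; exact: cst_continuous.
by rewrite -[g](subrK f) addrC; exact: differentiableD.
Unshelve. all: by end_near. Qed.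

Lemma diff_upto_le k l O f : (k <= l)%N -> diff_upto l O f -> diff_upto k O f.
Proof. by move=> kl cf vs y s; apply: cf; exact: leq_trans kl. Qed.

Lemma diff_upto_cst k O (a : R) : diff_upto k O (fun=> a).
Proof.
move=> vs y _ Oy.
have [b ->] : exists b : R, iterD vs (fun=> a) = cst b :> ('rV[R]_m -> R).
  elim: vs => [|v vs [b /= ->]]; first by exists a.
  by exists 0; apply/funext => z; exact: derive_cst.
exact: differentiable_cst.
Qed.

Lemma diff_upto_eq k O f g : open O -> (forall y, O y -> f y = g y) ->
  diff_upto k O f -> diff_upto k O g.
Proof.
move=> oO fg cf vs y sv Oy; apply: near_eq_differentiable (cf vs y sv Oy).
near=> z; apply: (iterD_eq oO fg); near: z.
by apply: open_nbhs_nbhs; split.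
Unshelve. all: by end_near. Qed.

(** The new derivative is the innermost one, so that calculus rules apply to f
    itself and the induction hypothesis to the resulting expression. *)
Lemma diff_uptoS k O f : diff_upto k.+1 O f <->
  (forall y, O y -> differentiable f y) /\ forall v, diff_upto k O ('D_v f).
Proof.
have rc vs v : iterD (rcons vs v) f = iterD vs ('D_v f).
  by rewrite /Defs.iterD foldr_rcons.
split=> [cf|[df cf] vs]; first split=> [|v vs] y.
- exact: (cf [::]).
- by move=> sv Oy; rewrite -rc; apply: cf; rewrite ?size_rcons.
- case/lastP: vs => [|vs v] y; first by move=> _; exact: df.
  by rewrite size_rcons rc; exact: cf.
Qed.

Lemma diff_uptoD k O f g : open O -> diff_upto k O f -> diff_upto k O g ->
  diff_upto k O (f + g).
Proof.
move=> oO; elim: k f g => [|k IH] f g.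
  move=> cf cg [] //= y _ Oy.
  exact: (differentiableD (cf [::] _ _ Oy) (cg [::] _ _ Oy)).
move=> /diff_uptoS[df cf] /diff_uptoS[dg cg]; apply/diff_uptoS; split=> [y Oy|v].
  exact: (differentiableD (df _ Oy) (dg _ Oy)).
apply: diff_upto_eq (IH _ _ (cf v) (cg v)) => // y Oy.
by rewrite deriveD //; apply: diff_derivable; [exact: df | exact: dg].
Qed.

Lemma diff_uptoM k O f g : open O -> diff_upto k O f -> diff_upto k O g ->
  diff_upto k O (f * g).
Proof.
move=> oO; elim: k f g => [|k IH] f g.
  move=> cf cg [] //= y _ Oy.
  exact: (differentiableM (cf [::] _ _ Oy) (cg [::] _ _ Oy)).
move=> cf' cg'; have cf0 := diff_upto_le (leqnSn k) cf'.
have cg0 := diff_upto_le (leqnSn k) cg'.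
move: cf' cg' => /diff_uptoS[df cf] /diff_uptoS[dg cg].
apply/diff_uptoS; split=> [y Oy|v].
  exact: (differentiableM (df _ Oy) (dg _ Oy)).
apply: diff_upto_eq (diff_uptoD oO (IH _ _ cf0 (cg v)) (IH _ _ cg0 (cf v))) => //.
move=> y Oy.
by rewrite deriveM //; apply: diff_derivable; [exact: df | exact: dg].
Qed.

Lemma diff_upto_subset k O O' f : O `<=` O' -> diff_upto k O' f -> diff_upto k O f.
Proof. by move=> sO cf vs y sv Oy; apply: cf => //; exact: sO. Qed.

Lemma diff_upto_coord k O (i : 'I_m) : diff_upto k O (fun y => y ord0 i).
Proof.
case: k => [|k]; first by case=> // y _ _; exact: differentiable_coord.
apply/diff_uptoS; split=> [y _|v]; first exact: differentiable_coord.
have -> : 'D_v (fun y : 'rV[R]_m => y ord0 i) = fun=> v ord0 i.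
  apply/funext => y; rewrite deriveE; last exact: differentiable_coord.
  have @l : {linear 'rV[R]_m -> R}.
    by exists (fun z : 'rV[R]_m => z ord0 i); do 2![eexists]; do ?[constructor];
      rewrite ?mxE // => ? *; rewrite ?mxE //; move=> ?; rewrite !mxE.
  by rewrite (_ : (fun _ => _) = l) // diff_lin //; exact: coord_continuous.
exact: diff_upto_cst.
Qed.

End IteratedDerivatives.

(** * Smooth functions and tangent vectors *)

Lemma nearP (T : topologicalType) (p : T) (P : T -> Prop) :
  (\forall q \near p, P q) <->
  exists U, [/\ open U, U p & forall q, U q -> P q].
Proof.
split=> [|[U [oU Up UP]]]; last first.
  by apply: (filterS UP); exact: open_nbhs_nbhs.
move=> nP; have : nbhs p [set q | P q] := nP.
by rewrite nbhsE => -[U [oU Up] UP]; exists U.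
Qed.

(** Smoothness is tested in each chart separately, so its closure properties
    rest on each chart being a homeomorphism between open sets. *)
Record open_charts (R : realType) (m : nat) (M : riem R m) : Prop := {
  charts_open : forall c : chart R m M, atlas c ->
    open (dom c) /\ open (ccoord c @` dom c);
  charts_homeo : forall c : chart R m M, atlas c -> forall p, dom c p ->
    [/\ param c (ccoord c p) = p,
        {for p, continuous (ccoord c)} &
        {for ccoord c p, continuous (param c)}] }.

Section SmoothFunctions.
Context {R : realType} {m : nat} {M : riem R m}.
Hypothesis charts : open_charts M.
Implicit Types (f g : M -> R) (p q : M) (U : set M).

Definition chart_image (c : chart R m M) U := ccoord c @` (U `&` dom c).

Lemma open_chart_image c U : atlas c -> open U -> open (chart_image c U).
Proof.
move=> ac oU; rewrite openE => _ [r [Ur cr]] <-.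
have [_ oc] := charts_open charts ac.
have [pr _ ctr] := charts_homeo charts ac cr.
have nU : \forall z \near ccoord c r, U (param c z).
  apply: ctr; rewrite pr; apply: open_nbhs_nbhs; exact: (conj oU Ur).
have nd : \forall z \near ccoord c r, (ccoord c @` dom c) z.
  by apply: open_nbhs_nbhs; split => //; exists r.
rewrite /interior; apply: filterS2 nU nd => z Uz [r' cr' rz].
exists r' => //; split=> //.
by have [<- _ _] := charts_homeo charts ac cr'; rewrite rz.
Qed.

(** One neighbourhood serves all charts and all orders of differentiation; its
    images in the charts are open, where the rules of calculus hold. *)
Lemma smoothP f p : smooth f p <->
  exists U, [/\ open U, U p & forall c, atlas c -> forall k,
    diff_upto k (chart_image c U) (f \o param c)].
Proof.
split.
  move=> /nearP[U [oU Up sf]]; exists U; split=> // c ac k vs y _.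
  by move=> [r [Ur cr] <-]; exact: sf.
move=> [U [oU Up sf]]; apply/nearP; exists U; split=> // q Uq c ac cq vs.
by apply: (sf c ac (size vs)) => //; exists q.
Qed.

Lemma smooth_near f p : smooth f p -> \forall q \near p, smooth f q.
Proof.
move=> /smoothP[U [oU Up sf]]; apply/nearP; exists U; split=> // q Uq.
by apply/smoothP; exists U.
Qed.

Lemma smooth_germ f g p : smooth f p -> (\forall q \near p, f q = g q) ->
  smooth g p.
Proof.
move=> /smoothP[U [oU Up sf]] /nearP[V [oV Vp fg]].
apply/smoothP; exists (U `&` V); split=> [||c ac k]; first exact: openI.
  by split.
apply: (@diff_upto_eq _ _ _ _ (f \o param c)); last 1 first.
- apply: diff_upto_subset (sf c ac k) => y [r [[Ur Vr] cr] <-].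
  by exists r.
- by apply: open_chart_image => //; exact: openI.
move=> _ [r [[Ur Vr] cr] <-] /=.
by have [-> _ _] := charts_homeo charts ac cr; exact: fg.
Qed.

Lemma smooth_cst (a : R) p : smooth (fun=> a) p.
Proof.
apply/smoothP; exists setT; split=> // [|c ac k]; first exact: openT.
exact: diff_upto_cst.
Qed.

Lemma smooth2 (h : R -> R -> R) f g p :
  (forall k (O : set 'rV[R]_m) u v, open O -> diff_upto k O u ->
     diff_upto k O v -> diff_upto k O (fun y => h (u y) (v y))) ->
  smooth f p -> smooth g p -> smooth (fun q => h (f q) (g q)) p.
Proof.
move=> hh /smoothP[U [oU Up sf]] /smoothP[V [oV Vp sg]].
apply/smoothP; exists (U `&` V); split=> [||c ac k]; first exact: openI.
  by split.
apply: hh; first by apply: open_chart_image => //; exact: openI.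
- by apply: diff_upto_subset (sf c ac k) => y [r [[Ur Vr] cr] <-]; exists r.
- by apply: diff_upto_subset (sg c ac k) => y [r [[Ur Vr] cr] <-]; exists r.
Qed.

Lemma smoothD f g p : smooth f p -> smooth g p ->
  smooth (fun q => f q + g q) p.
Proof. by apply: (@smooth2 +%R) => *; exact: diff_uptoD. Qed.

Lemma smoothM f g p : smooth f p -> smooth g p ->
  smooth (fun q => f q * g q) p.
Proof. by apply: (@smooth2 *%R) => *; exact: diff_uptoM. Qed.

Lemma smoothN f p : smooth f p -> smooth (fun q => - f q) p.
Proof.
move=> sf; under eq_fun do rewrite -mulN1r.
by apply: smoothM => //; exact: smooth_cst.
Qed.

Lemma smooth_sum (I : Type) (s : seq I) (f : I -> M -> R) p :
  (forall i, smooth (f i) p) -> smooth (fun q => \sum_(i <- s) f i q) p.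
Proof.
move=> sf; elim: s => [|i s IH].
  by under eq_fun do rewrite big_nil; exact: smooth_cst.
by under eq_fun do rewrite big_cons; exact: smoothD.
Qed.

Section Tangent.
Context {p : M}.
Implicit Types (u v : vec M).

(** The Leibniz rule for 1 = 1 * 1. *)
Lemma tangent_cst u a : tangent p u -> u (fun=> a) = 0.
Proof.
move=> tu; have s1 a' := smooth_cst a' p.
have u1 : u (fun=> 1) = 0.
  have := tangent_leibniz tu (s1 1) (s1 1).
  under eq_fun do rewrite mul1r.
  by rewrite mul1r => e; apply: (addrI (u (fun=> 1))); rewrite addr0 -e.
have u0 : u (fun=> 0) = 0.
  have := tangent_linear tu 1 (s1 0) (s1 0).
  under eq_fun do rewrite mulr0 addr0.
  by rewrite mul1r => e; apply: (addrI (u (fun=> 0))); rewrite addr0 -e.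
have := tangent_linear tu a (s1 1) (s1 0).
by rewrite u1 u0; under eq_fun do rewrite mulr1 addr0; rewrite mulr0 addr0.
Qed.

Lemma tangentD_fun u f g : tangent p u -> smooth f p -> smooth g p ->
  u (fun q => f q + g q) = u f + u g :> R.
Proof.
move=> tu sf sg; have := tangent_linear tu 1 sf sg.
by rewrite mul1r; under eq_fun do rewrite mul1r.
Qed.

Lemma tangentZ_fun u a f : tangent p u -> smooth f p ->
  u (fun q => a * f q) = a * u f :> R.
Proof.
move=> tu sf; have := tangent_linear tu a sf (smooth_cst 0 p).
by rewrite (tangent_cst _ tu) addr0; under eq_fun do rewrite addr0.
Qed.

Lemma tangentN_fun u f : tangent p u -> smooth f p ->
  u (fun q => - f q) = - u f :> R.
Proof.
by move=> tu sf; under eq_fun do rewrite -mulN1r; rewrite tangentZ_fun // mulN1r.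
Qed.

Lemma tangentB_fun u f g : tangent p u -> smooth f p -> smooth g p ->
  u (fun q => f q - g q) = u f - u g :> R.
Proof.
by move=> tu sf sg; rewrite tangentD_fun ?tangentN_fun //; exact: smoothN.
Qed.

Lemma tangent_sum_fun (I : Type) (s : seq I) u (f : I -> M -> R) :
  tangent p u -> (forall i, smooth (f i) p) ->
  u (fun q => \sum_(i <- s) f i q) = \sum_(i <- s) u (f i) :> R.
Proof.
move=> tu sf; elim: s => [|i s IH].
  by under eq_fun do rewrite big_nil; rewrite big_nil tangent_cst.
under eq_fun do rewrite big_cons; rewrite big_cons -IH tangentD_fun //.
exact: smooth_sum.
Qed.

Lemma tangentP u v (a : R) : tangent p u -> tangent p v -> tangent p (a *: u + v).
Proof.
move=> tu tv; split.
- move=> f g sf sg fg; rewrite !fctE.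
  by rewrite (tangent_germ tu sf sg fg) (tangent_germ tv sf sg fg).
- move=> b f g sf sg; rewrite !fctE.
  rewrite (tangent_linear tu b sf sg) (tangent_linear tv b sf sg).
  rewrite scalerDr mulrDr !addrA; congr (_ + _); rewrite -!addrA; congr (_ + _).
    by rewrite /GRing.scale /= mulrCA.
  by rewrite addrC.
- move=> f g sf sg; rewrite !fctE.
  rewrite (tangent_leibniz tu sf sg) (tangent_leibniz tv sf sg).
  rewrite /GRing.scale /=; ring.
- move=> f sf; rewrite !fctE (tangent_zero tu sf) (tangent_zero tv sf).
  by rewrite scaler0 addr0.
Qed.

Lemma tangent0 : tangent p (0 : vec M).
Proof.
have e f : (0 : vec M) f = 0 by [].
by split=> *; rewrite !e ?mulr0 ?addr0.
Qed.

Lemma tangentD u v : tangent p u -> tangent p v -> tangent p (u + v).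
Proof. by rewrite -[u in u + v]scale1r; exact: tangentP. Qed.

Lemma tangentZ a u : tangent p u -> tangent p (a *: u).
Proof. by move=> tu; rewrite -[_ *: _]addr0; apply: tangentP => //; exact: tangent0. Qed.

Lemma tangentN u : tangent p u -> tangent p (- u).
Proof. by rewrite -scaleN1r; exact: tangentZ. Qed.

Lemma tangent_sum (I : Type) (s : seq I) (u : I -> vec M) :
  (forall i, tangent p (u i)) -> tangent p (\sum_(i <- s) u i).
Proof.
move=> tu; elim/big_ind: _ => // [|x y]; [exact: tangent0|exact: tangentD].
Qed.

End Tangent.

End SmoothFunctions.

(** * Fields, metric and Levi-Civita connection *)

Create HintDb sm.
(** Closes the smoothness and tangency conditions by the closure lemmas. *)
Ltac sm := solve [eauto 16 with sm].
(** Vectors are functions with values in R, so that a linear identity between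
    them becomes a ring identity after evaluation. *)
Ltac vring := apply/funext => ?; rewrite ?fctE /GRing.scale /=; ring.

(** The local rules shared by Riemannian manifolds and by [euclidean].
    Nondegeneracy of the metric comes from orthonormal frames, which in
    Euclidean space also show that a tangent vector is determined by its
    coordinates. *)
Record calculus (R : realType) (m : nat) (M : riem R m)
    (D : vfield M -> vfield M -> vfield M) : Prop := {
  calc_charts : open_charts M;
  calc_linear : forall (p : M) (a : R) (u v w : vec M),
    tangent p u -> tangent p v -> tangent p w ->
    metric p (a *: u + v) w = a * metric p u w + metric p v w;
  calc_sym : forall (p : M) (u w : vec M),
    tangent p u -> tangent p w -> metric p u w = metric p w u;
  calc_smooth : forall (p : M) (X Y : vfield M),
    smooth_field X p -> smooth_field Y p ->
    smooth (fun q => metric q (X q) (Y q)) p;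
  calc_lc : levi_civita D }.

Section Calculus.
Context {R : realType} {m : nat} {M : riem R m}.
Context {D : vfield M -> vfield M -> vfield M}.
Hypothesis HD : calculus D.
Let charts := calc_charts HD.
Let lc := calc_lc HD.
Implicit Types (f g : M -> R) (p q : M) (u v w : vec M) (X Y Z W : vfield M).

Lemma field_near X p : smooth_field X p -> \forall q \near p, smooth_field X q.
Proof.
move=> /nearP[U [oU Up XU]]; apply/nearP; exists U; split=> // q Uq.
by apply/nearP; exists U.
Qed.

Lemma field_tangent X p : smooth_field X p -> tangent p (X p).
Proof. by move=> /nearP[U [_ Up /(_ p Up)[]]]. Qed.

Lemma smooth_app X f p : smooth_field X p -> smooth f p ->
  smooth (fun q => X q f) p.
Proof. by move=> /nearP[U [_ Up /(_ p Up)[_]]]; apply. Qed.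

Lemma field_germ X Y p : smooth_field X p -> (\forall q \near p, X q = Y q) ->
  smooth_field Y p.
Proof.
move=> /nearP[U [oU Up XU]] /nearP[V [oV Vp XY]].
apply/nearP; exists (U `&` V); split=> [||q [Uq Vq]]; first exact: openI.
  by split.
have [tX sX] := XU q Uq; split=> [|f sf]; first by rewrite -XY.
apply: (smooth_germ charts (sX f sf)).
by apply/nearP; exists V; split=> // r Vr; rewrite XY.
Qed.

Lemma fieldD X Y p : smooth_field X p -> smooth_field Y p ->
  smooth_field (fun q => X q + Y q) p.
Proof.
move=> /nearP[U [oU Up XU]] /nearP[V [oV Vp YV]].
apply/nearP; exists (U `&` V); split=> [||q [Uq Vq]]; first exact: openI.
  by split.
have [tX sX] := XU q Uq; have [tY sY] := YV q Vq.
by split=> [|f sf]; [exact: tangentD | exact: smoothD (sX f sf) (sY f sf)].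
Qed.

Lemma fieldZ f X p : smooth f p -> smooth_field X p ->
  smooth_field (fun q => f q *: X q) p.
Proof.
move=> /(smooth_near (M := M))/nearP[U [oU Up fU]] /nearP[V [oV Vp XV]].
apply/nearP; exists (U `&` V); split=> [||q [Uq Vq]]; first exact: openI.
  by split.
have [tX sX] := XV q Vq.
by split=> [|g sg]; [exact: tangentZ | exact: smoothM (fU q Uq) (sX g sg)].
Qed.

Lemma field0 p : smooth_field (fun=> 0 : vec M) p.
Proof.
apply/nearP; exists setT; split=> [||q _] //; first exact: openT.
by split=> [|f _]; [exact: tangent0 | exact: smooth_cst].
Qed.

Lemma field_scale (a : R) X p : smooth_field X p ->
  smooth_field (fun q => a *: X q) p.
Proof. by apply: fieldZ; exact: smooth_cst. Qed.

Lemma fieldN X p : smooth_field X p -> smooth_field (fun q => - X q) p.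
Proof. by move=> /(field_scale (-1)); under eq_fun do rewrite scaleN1r. Qed.

Lemma fieldB X Y p : smooth_field X p -> smooth_field Y p ->
  smooth_field (fun q => X q - Y q) p.
Proof. by move=> sX sY; apply: fieldD => //; exact: fieldN. Qed.

Lemma field_sum (I : Type) (s : seq I) (X : I -> vfield M) p :
  (forall i, smooth_field (X i) p) ->
  smooth_field (fun q => \sum_(i <- s) X i q) p.
Proof.
move=> sX; elim: s => [|i s IH].
  by under eq_fun do rewrite big_nil; exact: field0.
by under eq_fun do rewrite big_cons; exact: fieldD.
Qed.

Lemma fieldDD X Y p : smooth_field X p -> smooth_field Y p ->
  smooth_field (D X Y) p.
Proof. exact: (lc_smooth lc). Qed.

Lemma lie_near X Y p : smooth_field X p -> smooth_field Y p ->
  \forall q \near p, D X Y q - D Y X q = lie X Y q.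
Proof.
move=> /field_near sX /field_near sY; near=> q.
by apply: (lc_torsion_free lc); [near: q | near: q].
Unshelve. all: by end_near. Qed.

Lemma field_lie X Y p : smooth_field X p -> smooth_field Y p ->
  smooth_field (lie X Y) p.
Proof.
move=> sX sY; apply: field_germ (lie_near sX sY).
by apply: fieldB; exact: fieldDD.
Qed.

Lemma lieE X Y p f : smooth f p ->
  lie X Y p f = X p (fun q => Y q f) - Y p (fun q => X q f) :> R.
Proof. by move=> sf; rewrite /lie; case: asboolP. Qed.

Lemma lieC X Y : lie X Y = fun p => - lie Y X p.
Proof.
apply/funext => p; apply/funext => f; rewrite fctE /lie.
by case: asboolP => _; rewrite ?opprB ?oppr0.
Qed.

Lemma smooth_metric X Y p : smooth_field X p -> smooth_field Y p ->
  smooth (fun q => metric q (X q) (Y q)) p.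
Proof. exact: (calc_smooth HD). Qed.

Section Metric.
Context {p : M}.
Local Notation "<| u , v |>" := (metric p u v).

Lemma metricC u v : tangent p u -> tangent p v -> <|u, v|> = <|v, u|>.
Proof. exact: (calc_sym HD). Qed.

Lemma metricDl u v w : tangent p u -> tangent p v -> tangent p w ->
  <|u + v, w|> = <|u, w|> + <|v, w|>.
Proof. by move=> *; rewrite -[u in u + v]scale1r (calc_linear HD) // mul1r. Qed.

Lemma metric0l w : tangent p w -> <|0, w|> = 0.
Proof.
move=> tw; have t0 := @tangent0 _ _ M p.
have := metricDl t0 t0 tw; rewrite addr0 => e.
by apply: (addrI <|0, w|>); rewrite addr0 -e.
Qed.

Lemma metricZl a u w : tangent p u -> tangent p w -> <|a *: u, w|> = a * <|u, w|>.
Proof.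
move=> tu tw; rewrite -[_ *: u]addr0 (calc_linear HD) //; last exact: tangent0.
by rewrite metric0l // addr0.
Qed.

Lemma metricNl u w : tangent p u -> tangent p w -> <|- u, w|> = - <|u, w|>.
Proof. by move=> tu tw; rewrite -scaleN1r metricZl // mulN1r. Qed.

Lemma metricBl u v w : tangent p u -> tangent p v -> tangent p w ->
  <|u - v, w|> = <|u, w|> - <|v, w|>.
Proof. by move=> *; rewrite metricDl ?metricNl //; exact: tangentN. Qed.

Lemma metric_suml (I : Type) (s : seq I) (u : I -> vec M) w :
  (forall i, tangent p (u i)) -> tangent p w ->
  <|\sum_(i <- s) u i, w|> = \sum_(i <- s) <|u i, w|>.
Proof.
move=> tu tw; elim: s => [|i s IH]; first by rewrite !big_nil metric0l.
by rewrite !big_cons metricDl ?IH //; exact: tangent_sum.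
Qed.

Lemma metricDr u v w : tangent p u -> tangent p v -> tangent p w ->
  <|u, v + w|> = <|u, v|> + <|u, w|>.
Proof.
by move=> tu tv tw; rewrite ![<|u, _|>]metricC ?metricDl //; exact: tangentD.
Qed.

Lemma metricZr a u w : tangent p u -> tangent p w -> <|u, a *: w|> = a * <|u, w|>.
Proof.
by move=> tu tw; rewrite ![<|u, _|>]metricC ?metricZl //; exact: tangentZ.
Qed.

Lemma metric_sumr (I : Type) (s : seq I) u (v : I -> vec M) :
  tangent p u -> (forall i, tangent p (v i)) ->
  <|u, \sum_(i <- s) v i|> = \sum_(i <- s) <|u, v i|>.
Proof.
move=> tu tv; rewrite metricC ?metric_suml //; last exact: tangent_sum.
by apply: eq_bigr => i _; rewrite metricC.
Qed.

End Metric.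

Hint Resolve fieldD fieldZ fieldN field_sum fieldDD field_lie field0 : sm.
Hint Resolve smooth_metric smooth_app : sm.
Hint Resolve smoothD smoothM smooth_cst smoothN smooth_sum calc_charts : sm.
Hint Resolve tangentD tangentZ tangentN tangent_sum tangent0 | 1 : sm.
Hint Resolve field_tangent | 2 : sm.

Lemma conn0l X p : smooth_field X p -> D (fun=> 0) X p = 0.
Proof.
move=> sX; have := lc_linear_l lc (@smooth_cst _ _ M (-1) p) sX sX sX.
under eq_fun do rewrite scaleN1r addNr.
by rewrite scaleN1r addNr.
Qed.

Lemma connDl X Y Z p : smooth_field X p -> smooth_field Y p -> smooth_field Z p ->
  D (fun q => X q + Y q) Z p = D X Z p + D Y Z p.
Proof.
move=> sX sY sZ; have := lc_linear_l lc (smooth_cst 1 p) sX sY sZ.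
by rewrite scale1r => <-; under [in RHS]eq_fun do rewrite scale1r.
Qed.

Lemma connZl f X Z p : smooth f p -> smooth_field X p -> smooth_field Z p ->
  D (fun q => f q *: X q) Z p = f p *: D X Z p.
Proof.
move=> sf sX sZ; have := lc_linear_l lc sf sX (field0 p) sZ.
by rewrite conn0l // addr0 => <-; under [in RHS]eq_fun do rewrite addr0.
Qed.

Lemma connNl X Z p : smooth_field X p -> smooth_field Z p ->
  D (fun q => - X q) Z p = - D X Z p.
Proof.
move=> sX sZ; under eq_fun do rewrite -scaleN1r.
by rewrite (connZl (f := fun=> -1)) ?scaleN1r //; sm.
Qed.

Lemma connBl X Y Z p : smooth_field X p -> smooth_field Y p -> smooth_field Z p ->
  D (fun q => X q - Y q) Z p = D X Z p - D Y Z p.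
Proof. by move=> *; rewrite connDl ?connNl //; sm. Qed.

Lemma conn_suml (I : Type) (s : seq I) (X : I -> vfield M) Z p :
  (forall i, smooth_field (X i) p) -> smooth_field Z p ->
  D (fun q => \sum_(i <- s) X i q) Z p = \sum_(i <- s) D (X i) Z p.
Proof.
move=> sX sZ; elim: s => [|i s IH].
  by under eq_fun do rewrite big_nil; rewrite big_nil conn0l.
under eq_fun do rewrite big_cons.
by rewrite big_cons connDl ?IH //; sm.
Qed.

Lemma connDr X Y Z p : smooth_field X p -> smooth_field Y p -> smooth_field Z p ->
  D X (fun q => Y q + Z q) p = D X Y p + D X Z p.
Proof. exact: (lc_add_r lc). Qed.

Lemma connZr f X Y p : smooth f p -> smooth_field X p -> smooth_field Y p ->
  D X (fun q => f q *: Y q) p = X p f *: Y p + f p *: D X Y p.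
Proof. exact: (lc_leibniz lc). Qed.

Lemma conn_scaler (a : R) X Y p : smooth_field X p -> smooth_field Y p ->
  D X (fun q => a *: Y q) p = a *: D X Y p.
Proof.
move=> sX sY; rewrite (connZr (f := fun=> a)) //; last by sm.
by rewrite (tangent_cst _ (field_tangent sX)) scale0r add0r.
Qed.

Lemma connNr X Y p : smooth_field X p -> smooth_field Y p ->
  D X (fun q => - Y q) p = - D X Y p.
Proof.
by move=> *; under eq_fun do rewrite -scaleN1r; rewrite conn_scaler // scaleN1r.
Qed.

Lemma connBr X Y Z p : smooth_field X p -> smooth_field Y p -> smooth_field Z p ->
  D X (fun q => Y q - Z q) p = D X Y p - D X Z p.
Proof. by move=> *; rewrite connDr ?connNr //; sm. Qed.

Lemma conn_sumr (I : Type) (s : seq I) X (Y : I -> vfield M) p :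
  smooth_field X p -> (forall i, smooth_field (Y i) p) ->
  D X (fun q => \sum_(i <- s) Y i q) p = \sum_(i <- s) D X (Y i) p.
Proof.
move=> sX sY; elim: s => [|i s IH].
  under eq_fun do rewrite big_nil -(scale0r 0).
  by rewrite big_nil conn_scaler ?scale0r //; sm.
under eq_fun do rewrite big_cons.
by rewrite big_cons connDr ?IH //; sm.
Qed.

Lemma conn_eq X X' Y Y' p : smooth_field X p -> smooth_field Y p ->
  (\forall q \near p, X q = X' q) -> (\forall q \near p, Y q = Y' q) ->
  D X Y p = D X' Y' p.
Proof.
move=> sX sY eX eY; apply: (lc_local lc) => //; first exact: field_germ eX.
exact: field_germ eY.
Qed.

Lemma conn_eql X X' Y p : smooth_field X p -> smooth_field Y p ->
  (\forall q \near p, X q = X' q) -> D X Y p = D X' Y p.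
Proof. by move=> sX sY eX; apply: conn_eq => //; near do by []. Unshelve. all: by end_near. Qed.

Lemma conn_eqr X Y Y' p : smooth_field X p -> smooth_field Y p ->
  (\forall q \near p, Y q = Y' q) -> D X Y p = D X Y' p.
Proof. by move=> sX sY eY; apply: conn_eq => //; near do by []. Unshelve. all: by end_near. Qed.

Lemma conn_torsion X Y p : smooth_field X p -> smooth_field Y p ->
  D X Y p - D Y X p = lie X Y p.
Proof. exact: (lc_torsion_free lc). Qed.

Lemma app_eq X f g p : smooth_field X p -> smooth f p ->
  (\forall q \near p, f q = g q) -> X p f = X p g.
Proof.
move=> sX sf fg; apply: (tangent_germ (field_tangent sX) sf _ fg).
exact: (smooth_germ charts sf fg).
Qed.

Lemma app_metric X Y Z p : smooth_field X p -> smooth_field Y p ->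
  smooth_field Z p ->
  X p (fun q => metric q (Y q) (Z q)) =
    metric p (D X Y p) (Z p) + metric p (Y p) (D X Z p) :> R.
Proof. exact: (lc_metric lc). Qed.

(** The two mixed terms are exchanged when X and Y are, and therefore cancel in
    every commutator. *)
Lemma app_metric2 X Y Z W p : smooth_field X p -> smooth_field Y p ->
  smooth_field Z p -> smooth_field W p ->
  X p (fun q => Y q (fun r => metric r (Z r) (W r))) =
    metric p (D X (D Y Z) p) (W p) + metric p (D Y Z p) (D X W p)
    + (metric p (D X Z p) (D Y W p) + metric p (Z p) (D X (D Y W) p)) :> R.
Proof.
move=> sX sY sZ sW.
rewrite (@app_eq X _ (fun q => metric q (D Y Z q) (W q) + metric q (Z q) (D Y W q))).
- by rewrite (tangentD_fun (field_tangent sX)) ?app_metric //; sm.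
- by [].
- by sm.
near=> q; apply: app_metric; near: q; exact: field_near.
Unshelve. all: by end_near. Qed.

(** The right-hand side involves only the metric and brackets. Two connections
    are always compared through it: on M with the ambient one, and on Euclidean
    space with the derivative of the coordinates. *)
Lemma koszul X Y Z p : smooth_field X p -> smooth_field Y p -> smooth_field Z p ->
  metric p (D X Y p) (Z p) *+ 2 =
    (X p (fun q => metric q (Y q) (Z q)) : R)
    + (Y p (fun q => metric q (Z q) (X q)) : R)
    - (Z p (fun q => metric q (X q) (Y q)) : R)
    + metric p (lie X Y p) (Z p) - metric p (lie Y Z p) (X p)
    + metric p (lie Z X p) (Y p).
Proof.
move=> sX sY sZ; rewrite !app_metric // -!conn_torsion //.
rewrite !metricBl; try sm.
rewrite (metricC (u := Y p)); try sm.
rewrite (metricC (u := Z p)); try sm.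
rewrite (metricC (u := X p)); try sm.
ring.
Qed.

(** * Symmetries of the curvature *)

Lemma field_curv X Y Z p : smooth_field X p -> smooth_field Y p ->
  smooth_field Z p -> smooth_field (curv D X Y Z) p.
Proof.
move=> sX sY sZ; rewrite /curv.
by apply: fieldB; [apply: fieldB|]; sm.
Qed.
Hint Resolve field_curv : sm.

Lemma curvC X Y Z p : smooth_field X p -> smooth_field Y p -> smooth_field Z p ->
  curv D X Y Z p = - curv D Y X Z p.
Proof.
move=> sX sY sZ; rewrite /curv (lieC X Y) connNl; [|sm|sm].
by rewrite !opprB opprK addrC.
Qed.

(** Metric compatibility, applied to [X, Y] = X Y - Y X acting on the function
    g(Z, W), says that the curvature is skew. *)
Lemma curv_skew X Y Z W p : smooth_field X p -> smooth_field Y p ->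
  smooth_field Z p -> smooth_field W p ->
  metric p (curv D X Y Z p) (W p) = - metric p (curv D X Y W p) (Z p).
Proof.
move=> sX sY sZ sW.
have := app_metric (field_lie sX sY) sZ sW.
rewrite lieE ?app_metric2 //; try sm.
rewrite /curv !metricBl; try sm.
rewrite ![metric p (D _ _ p) (Z p)]metricC; try sm.
move=> /eqP; rewrite -subr_eq0 => /eqP e; apply/eqP; rewrite -addr_eq0.
by apply/eqP; rewrite -[RHS]e; ring.
Qed.

(** After evaluation on a function the twelve third derivatives cancel in pairs. *)
Lemma lie_jacobi X Y Z p : smooth_field X p -> smooth_field Y p ->
  smooth_field Z p ->
  lie X (lie Y Z) p + lie Y (lie Z X) p + lie Z (lie X Y) p = 0.
Proof.
have lie2 A B C f : smooth_field A p -> smooth_field B p -> smooth_field C p ->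
    smooth f p -> lie A (lie B C) p f =
      A p (fun q => B q (fun r => C r f)) - A p (fun q => C q (fun r => B r f))
      - (B p (fun q => C q (fun r => A r f)) - C p (fun q => B q (fun r => A r f))) :> R.
  move=> sA sB sC sf; rewrite !lieE //; last by sm.
  rewrite (@app_eq A _ (fun q => B q (fun r => C r f) - C q (fun r => B r f))).
  - by rewrite (tangentB_fun charts (field_tangent sA)) //; sm.
  - by [].
  - by sm.
  by near=> q; apply: lieE; near: q; exact: smooth_near.
move=> sX sY sZ; apply/funext => f.
have [sf|sf] := pselect (smooth f p); last first.
  by rewrite !fctE /lie; case: asboolP => // _; rewrite !addr0.
have : (lie X (lie Y Z) p f : R) + lie Y (lie Z X) p f + lie Z (lie X Y) p f = 0.
  by rewrite !lie2 //; ring.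
by [].
Unshelve. all: by end_near. Qed.

(** Without torsion, the cyclic sum of the curvatures equals the cyclic sum of
    the iterated brackets [X, [Y, Z]]. *)
Lemma curv_bianchi X Y Z p : smooth_field X p -> smooth_field Y p ->
  smooth_field Z p ->
  curv D X Y Z p + curv D Y Z X p + curv D Z X Y p = 0.
Proof.
have inner A B C : smooth_field A p -> smooth_field B p -> smooth_field C p ->
    D A (D B C) p - D A (D C B) p = D (lie B C) A p + lie A (lie B C) p.
  move=> sA sB sC; rewrite -connBr; try sm.
  rewrite (conn_eqr (Y' := lie B C)); [|sm|sm|exact: lie_near].
  by rewrite -conn_torsion; [rewrite addrC subrK|sm|sm].
move=> sX sY sZ; rewrite -(lie_jacobi sX sY sZ).
have -> : lie X (lie Y Z) p = D X (D Y Z) p - D X (D Z Y) p - D (lie Y Z) X p.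
  by rewrite inner // addrAC subrr add0r.
have -> : lie Y (lie Z X) p = D Y (D Z X) p - D Y (D X Z) p - D (lie Z X) Y p.
  by rewrite inner // addrAC subrr add0r.
have -> : lie Z (lie X Y) p = D Z (D X Y) p - D Z (D Y X) p - D (lie X Y) Z p.
  by rewrite inner // addrAC subrr add0r.
rewrite /curv; vring.
Qed.

(** The Bianchi identity for the four cyclic shifts of (X, Y, Z, W), combined
    by means of the two skew symmetries. *)
Lemma curv4_pair X Y Z W p : smooth_field X p -> smooth_field Y p ->
  smooth_field Z p -> smooth_field W p ->
  curv4 D X Y Z W p = curv4 D Z W X Y p.
Proof.
move=> sX sY sZ sW.
have bia A B C E : smooth_field A p -> smooth_field B p -> smooth_field C p ->
    smooth_field E p ->
    curv4 D A B C E p + curv4 D B C A E p + curv4 D C A B E p = 0.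
  move=> sA sB sC sE; rewrite /curv4 -!metricDl; try sm.
  by rewrite curv_bianchi // metric0l //; sm.
have ant A B C E : smooth_field A p -> smooth_field B p -> smooth_field C p ->
    smooth_field E p -> curv4 D A B C E p = - curv4 D B A C E p.
  move=> sA sB sC sE; rewrite /curv4 -metricNl; try sm.
  by rewrite -curvC.
have skw A B C E : smooth_field A p -> smooth_field B p -> smooth_field C p ->
    smooth_field E p -> curv4 D A B C E p = - curv4 D A B E C p.
  by move=> sA sB sC sE; exact: curv_skew.
have e1 := bia X Y Z W sX sY sZ sW.
have e2 := bia Y Z W X sY sZ sW sX.
have e3 := bia Z W X Y sZ sW sX sY.
have e4 := bia W X Y Z sW sX sY sZ.
move: (skw Y Z W X sY sZ sW sX) (skw Z W Y X sZ sW sY sX) (skw W Y Z X sW sY sZ sX).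
move: (skw W X Z Y sW sX sZ sY) (skw X Z W Y sX sZ sW sY) (skw X Y W Z sX sY sW sZ).
move: (skw Z X Y W sZ sX sY sW) (skw Y W X Z sY sW sX sZ).
move: (ant X Z Y W sX sZ sY sW) (ant W X Y Z sW sX sY sZ) (ant Y W X Z sY sW sX sZ).
move: (ant W X Z Y sW sX sZ sY) (ant W Y X Z sW sY sX sZ) (ant W Y Z X sW sY sZ sX).
move: (ant X Y W Z sX sY sW sZ) (ant Z X W Y sZ sX sW sY) (ant Y Z W X sY sZ sW sX).
move: (skw W X Y Z sW sX sY sZ).
lra.
Qed.

(** * Orthonormal frames and the deformation tensor *)

(** The skew family will be the connection coefficients of an orthonormal frame,
    and the symmetric one a second fundamental form or a symmetrised
    derivative: this is why frame derivatives disappear from traces. *)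
Lemma skew_sym_sum0 (I : finType) (V : lmodType R) (w : I -> I -> R)
    (B : I -> I -> V) :
  (forall a b, w a b = - w b a) -> (forall a b, B a b = B b a) ->
  \sum_a \sum_b w a b *: B a b = 0.
Proof.
move=> ww BB; set S := \sum_a _.
have : S = - S.
  rewrite {1}/S exchange_big /S -sumrN; apply: eq_bigr => a _.
  by rewrite -sumrN; apply: eq_bigr => b _; rewrite ww BB scaleNr.
move/eqP; rewrite -addr_eq0 -mulr2n -scaler_nat scaler_eq0 pnatr_eq0 /=.
by move/eqP.
Qed.

Section Frame.
Context {I : finType} {F : I -> vfield M} {U : set M}.

Definition frame_at q := [/\ (forall a, smooth_field (F a) q),
  (forall a b, metric q (F a q) (F b q) = (a == b)%:R) &
  forall u, tangent q u -> exists c : I -> R, u = \sum_a c a *: F a q].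

Lemma on_frame_near p : on_frame F p -> \forall q \near p, frame_at q.
Proof.
move=> [sF ons].
have sF' : \forall q \near p, forall a, smooth_field (F a) q.
  by apply: filter_forall => a; exact: field_near.
near=> q; have [on sp] : (forall a b, metric q (F a q) (F b q) = (a == b)%:R) /\
    (forall u, tangent q u -> exists c : I -> R, u = \sum_a c a *: F a q).
  by near: q.
by split=> //; near: q.
Unshelve. all: by end_near. Qed.

Hypothesis frame : forall q, U q -> frame_at q.
Hypothesis openU : open U.

Lemma frame_smooth q a : U q -> smooth_field (F a) q.
Proof. by move=> /frame[]. Qed.
Hint Resolve frame_smooth : sm.

Lemma near_in q (P : M -> Prop) : U q -> (forall r, U r -> P r) ->
  \forall r \near q, P r.
Proof. by move=> Uq UP; apply/nearP; exists U. Qed.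

Lemma frame_tangent q a : U q -> tangent q (F a q).
Proof. by sm. Qed.
Hint Resolve frame_tangent : sm.

Lemma metric_frame_sum q (c : I -> R) b : U q ->
  metric q (\sum_a c a *: F a q) (F b q) = c b.
Proof.
move=> Uq; have [sF on _] := frame Uq.
rewrite metric_suml; try sm.
rewrite (bigD1 b) //= metricZl; try sm.
rewrite on eqxx mulr1 big1 ?addr0 // => a ab.
by rewrite metricZl ?on ?(negbTE ab) ?mulr0 //; sm.
Qed.

Lemma frame_expand q u : U q -> tangent q u ->
  u = \sum_a metric q u (F a q) *: F a q.
Proof.
move=> Uq tu; have [sF on sp] := frame Uq.
have [c uc] := sp u tu; rewrite {1}uc; apply: eq_bigr => a _; congr (_ *: _).
by rewrite uc metric_frame_sum.
Qed.

Lemma frame_eq q u v : U q -> tangent q u -> tangent q v ->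
  (forall a, metric q u (F a q) = metric q v (F a q)) -> u = v.
Proof.
move=> Uq tu tv uv; rewrite (frame_expand Uq tu) (frame_expand Uq tv).
by apply: eq_bigr => a _; rewrite uv.
Qed.

Lemma field_near_in X q : U q -> smooth_field X q -> \forall r \near q,
  X r = \sum_a metric r (X r) (F a r) *: F a r.
Proof.
move=> Uq /field_near sX; near=> r; apply: frame_expand.
  by near: r; exact: near_in.
by apply: field_tangent; near: r.
Unshelve. all: by end_near. Qed.

(** Tensoriality in the direction of differentiation. *)
Lemma conn_expand_l X Y q : U q -> smooth_field X q -> smooth_field Y q ->
  D X Y q = \sum_a metric q (X q) (F a q) *: D (F a) Y q.
Proof.
move=> Uq sX sY; rewrite (conn_eql sX sY (field_near_in Uq sX)).
rewrite conn_suml; try sm.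
by apply: eq_bigr => a _; rewrite connZl //; sm.
Qed.

Lemma conn_pointwise X X' Y q : U q -> smooth_field X q -> smooth_field X' q ->
  smooth_field Y q -> X q = X' q -> D X Y q = D X' Y q.
Proof.
move=> Uq sX sX' sY XX'; rewrite (conn_expand_l Uq sX sY).
by rewrite (conn_expand_l Uq sX' sY) XX'.
Qed.

(** The functions g(F_a, F_b) are constant. *)
Lemma frame_conn_skew X a b q : U q -> smooth_field X q ->
  metric q (D X (F a) q) (F b q) = - metric q (D X (F b) q) (F a q).
Proof.
move=> Uq sX; have sF := fun a => frame_smooth a Uq.
have := app_metric sX (sF a) (sF b).
rewrite (@app_eq X _ (fun=> (a == b)%:R)); first last.
- by apply: near_in => // r /frame[].
- by sm.
- by [].
rewrite (tangent_cst _ (field_tangent sX)) => /eqP; rewrite eq_sym addr_eq0 => /eqP ->.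
by rewrite metricC //; sm.
Qed.

(** The second covariant derivative of v, whose skew part is the curvature. *)
Definition hess (v : vfield M) X Y q : vec M := D X (D Y v) q - D (D X Y) v q.

(** The derivatives of the frame contract a skew family with a symmetric one. *)
Lemma app_divergence (v : vfield M) X q : U q -> smooth_field X q -> smooth_field v q ->
  X q (divergence D F v) = \sum_a metric q (hess v X (F a) q) (F a q) :> R.
Proof.
move=> Uq sX sv; have sF := fun a => frame_smooth a Uq.
rewrite /divergence (tangent_sum_fun charts _ (field_tangent sX)); last by sm.
rewrite (eq_bigr _ (fun a _ => app_metric sX (fieldDD (sF a) sv) (sF a))).
rewrite -[RHS]addr0.
pose w a b := metric q (D X (F a) q) (F b q).
pose B a b := metric q (D (F a) v q) (F b q).
(* w: connection coefficients, skew; B + B^T: twice the deformation tensor. *)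
have sk : \sum_a \sum_b w a b * (B a b + B b a) = 0.
  apply: (@skew_sym_sum0 I R^o w (fun a b => B a b + B b a)) => a b.
    exact: frame_conn_skew.
  by rewrite addrC.
rewrite -[X in _ = _ + X]sk -big_split /=; apply: eq_bigr => a _; rewrite /hess metricBl; try sm.
rewrite (conn_expand_l Uq (X := D X (F a))); try sm.
rewrite metric_suml; try sm.
rewrite -addrA; congr (_ + _).
rewrite [X in _ = - X + _](eq_bigr (fun b => w a b * B b a)); last first.
  by move=> b _; rewrite metricZl //; sm.
rewrite -sumrN -big_split /=.
rewrite {1}(frame_expand Uq (field_tangent (fieldDD sX (sF a)))).
rewrite metric_sumr; try sm.
apply: eq_bigr => b _; rewrite metricZr; try sm.
by rewrite -/(w a b) -/(B a b); ring.
Qed.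

(** The derivatives of X and Y are exactly those absorbed by the second
    covariant derivative. *)
Lemma nabla2_def_tensor (v : vfield M) X Y Z q : smooth_field v q -> smooth_field X q ->
  smooth_field Y q -> smooth_field Z q ->
  nabla2 D (def_tensor D v) Z X Y q =
    2^-1 * (metric q (hess v Z X q) (Y q) + metric q (hess v Z Y q) (X q)).
Proof.
move=> sv sX sY sZ; rewrite /nabla2 /def_tensor /hess.
rewrite (tangentZ_fun _ (field_tangent sZ)); last by sm.
rewrite (tangentD_fun (field_tangent sZ)); try sm.
rewrite !app_metric; try sm.
rewrite !metricBl; try sm.
ring.
Qed.

(** In the coefficient along F_b, the half of the deformation tensor that
    differentiates v along F_a gives the Bochner Laplacian. In the other half
    the derivatives along F_a and F_b are exchanged; the commutator is the Ricci
    curvature, and the exchanged term is the derivative of the divergence. *)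
Theorem weitzenbock (v : vfield M) q : U q -> smooth_field v q ->
  (forall r, U r -> divergence D F v r = 0) ->
  -2 *: div_def D F v q = bochner D F v q - ric_op D F v q.
Proof.
move=> Uq sv div0; have sF := fun a => frame_smooth a Uq.
have tboch : tangent q (bochner D F v q).
  by rewrite /bochner; sm.
rewrite (frame_expand Uq tboch) /div_def /ric_op scaler_sumr -sumrB.
apply: eq_bigr => b _; rewrite scalerA -scalerBl; congr (_ *: _).
(* This is where the vanishing of the divergence is used. *)
have dvb : \sum_a metric q (hess v (F b) (F a) q) (F a q) = 0.
  rewrite -app_divergence //.
  have sdiv : smooth (divergence D F v) q by rewrite /divergence; sm.
  rewrite (app_eq (sF b) sdiv (g := fun=> 0)); last exact: near_in.
  exact: tangent_cst (field_tangent (sF b)).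
have -> : metric q (bochner D F v q) (F b q)
    = - \sum_a metric q (hess v (F a) (F a) q) (F b q).
  by rewrite /bochner metricNl ?metric_suml //; sm.
have -> : ric D F v (F b) q = \sum_a (metric q (hess v (F a) (F b) q) (F a q)
   - metric q (hess v (F b) (F a) q) (F a q)).
  apply: eq_bigr => a _; rewrite curv4_pair //.
  have -> : curv4 D (F b) (F a) (F a) v q = curv4 D (F a) (F b) v (F a) q.
    rewrite /curv4 curvC // metricNl; try sm.
    by rewrite curv_skew // opprK.
  rewrite /curv4 -metricBl; try by rewrite /hess; sm.
  congr (metric q _ _); rewrite /curv /hess.
  rewrite (conn_eql (X := lie (F a) (F b)) (X' := fun r => D (F a) (F b) r - D (F b) (F a) r)); try sm.
    by rewrite connBl; try sm; vring.
  apply: (filterS _ (lie_near (sF a) (sF b))) => r; exact: esym.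
rewrite [X in _ - X]sumrB dvb subr0 -opprD -big_split /= mulNr; congr (- _).
rewrite mulr_sumr; apply: eq_bigr => a _; rewrite nabla2_def_tensor //.
by rewrite mulrA divff ?mul1r.
Qed.

End Frame.

End Calculus.

#[local] Hint Resolve fieldD fieldZ fieldN field_sum fieldDD field_lie field0 : sm.
#[local] Hint Resolve smooth_metric smooth_app : sm.
#[local] Hint Resolve smoothD smoothM smooth_cst smoothN smooth_sum calc_charts : sm.
#[local] Hint Resolve tangentD tangentZ tangentN tangent_sum tangent0 | 1 : sm.
#[local] Hint Resolve field_tangent | 2 : sm.
#[local] Hint Resolve field_curv : sm.
Arguments frame_at {R m M I} F q.

(** * Tangential and normal projections *)

Section Projections.
Context {R : realType} {m n k : nat} {Mt : riem R m}.
Context {Dt : vfield Mt -> vfield Mt -> vfield Mt}.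
Hypothesis HDt : calculus Dt.
Context {Et : 'I_n -> vfield Mt} {N : 'I_k -> vfield Mt} {U : set Mt}.
Hypothesis openU : open U.
Hypothesis frame : forall x, U x -> frame_at (join_frame Et N) x.

(** The projections are written with the ambient frame, so that they turn a
    field defined near a point of M into another one, which can be
    differentiated. *)
Definition tproj (x : Mt) (w : vec Mt) : vec Mt :=
  \sum_i metric x w (Et i x) *: Et i x.
Definition nproj (x : Mt) (w : vec Mt) : vec Mt :=
  \sum_l metric x w (N l x) *: N l x.

Lemma smooth_Et x i : U x -> smooth_field (Et i) x.
Proof. by move=> /frame[/(_ (inl i))]. Qed.
Lemma smooth_N x l : U x -> smooth_field (N l) x.
Proof. by move=> /frame[/(_ (inr l))]. Qed.
Hint Resolve smooth_Et smooth_N : sm.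
Lemma tangent_Et x i : U x -> tangent x (Et i x). Proof. by sm. Qed.
Lemma tangent_N x l : U x -> tangent x (N l x). Proof. by sm. Qed.
Hint Resolve tangent_Et tangent_N : sm.

Lemma metric_Et x i j : U x -> metric x (Et i x) (Et j x) = (i == j)%:R.
Proof. by move=> /frame[_ /(_ (inl i) (inl j))]. Qed.
Lemma metric_N x l l' : U x -> metric x (N l x) (N l' x) = (l == l')%:R.
Proof. by move=> /frame[_ /(_ (inr l) (inr l'))]. Qed.
Lemma metric_EtN x i l : U x -> metric x (Et i x) (N l x) = 0.
Proof. by move=> /frame[_ /(_ (inl i) (inr l))]. Qed.
Lemma metric_NEt x i l : U x -> metric x (N l x) (Et i x) = 0.
Proof. by move=> /frame[_ /(_ (inr l) (inl i))]. Qed.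

Lemma tangent_tproj x w : U x -> tangent x (tproj x w).
Proof. by move=> Ux; rewrite /tproj; sm. Qed.
Lemma tangent_nproj x w : U x -> tangent x (nproj x w).
Proof. by move=> Ux; rewrite /nproj; sm. Qed.
Hint Resolve tangent_tproj tangent_nproj : sm.

Lemma smooth_tproj X x : U x -> smooth_field X x ->
  smooth_field (fun y => tproj y (X y)) x.
Proof. by move=> Ux sX; rewrite /tproj; sm. Qed.
Lemma smooth_nproj X x : U x -> smooth_field X x ->
  smooth_field (fun y => nproj y (X y)) x.
Proof. by move=> Ux sX; rewrite /nproj; sm. Qed.
Hint Resolve smooth_tproj smooth_nproj : sm.

Lemma proj_split x w : U x -> tangent x w -> tproj x w + nproj x w = w.
Proof.
by move=> Ux tw; rewrite [RHS](frame_expand HDt frame Ux tw) big_sumType.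
Qed.

Lemma tprojE x w : U x -> tangent x w -> tproj x w = w - nproj x w.
Proof. by move=> Ux tw; rewrite -{2}(proj_split Ux tw) addrK. Qed.

Section Linear.
Variable x : Mt.
Hypothesis Ux : U x.
Implicit Types u w : vec Mt.

Lemma tprojD u w : tangent x u -> tangent x w ->
  tproj x (u + w) = tproj x u + tproj x w.
Proof.
move=> tu tw; rewrite -big_split /=; apply: eq_bigr => i _.
by rewrite (metricDl HDt) ?scalerDl //; sm.
Qed.
Lemma tprojZ a u : tangent x u -> tproj x (a *: u) = a *: tproj x u.
Proof.
move=> tu; rewrite scaler_sumr; apply: eq_bigr => i _.
by rewrite (metricZl HDt) ?scalerA //; sm.
Qed.
Lemma tprojN u : tangent x u -> tproj x (- u) = - tproj x u.
Proof. by move=> tu; rewrite -scaleN1r tprojZ // scaleN1r. Qed.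
Lemma tprojB u w : tangent x u -> tangent x w ->
  tproj x (u - w) = tproj x u - tproj x w.
Proof. by move=> tu tw; rewrite tprojD ?tprojN //; sm. Qed.
Lemma tproj0 : tproj x 0 = 0.
Proof. by rewrite -[0 in LHS](scale0r 0) tprojZ ?scale0r //; sm. Qed.
Lemma tproj_sum (I : Type) (s : seq I) (u : I -> vec Mt) :
  (forall i, tangent x (u i)) ->
  tproj x (\sum_(i <- s) u i) = \sum_(i <- s) tproj x (u i).
Proof.
move=> tu; elim: s => [|i s IH]; first by rewrite !big_nil tproj0.
by rewrite !big_cons tprojD ?IH //; sm.
Qed.

Lemma nprojD u w : tangent x u -> tangent x w ->
  nproj x (u + w) = nproj x u + nproj x w.
Proof.
move=> tu tw; rewrite -big_split /=; apply: eq_bigr => i _.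
by rewrite (metricDl HDt) ?scalerDl //; sm.
Qed.
Lemma nprojZ a u : tangent x u -> nproj x (a *: u) = a *: nproj x u.
Proof.
move=> tu; rewrite scaler_sumr; apply: eq_bigr => i _.
by rewrite (metricZl HDt) ?scalerA //; sm.
Qed.
Lemma nprojN u : tangent x u -> nproj x (- u) = - nproj x u.
Proof. by move=> tu; rewrite -scaleN1r nprojZ // scaleN1r. Qed.
Lemma nprojB u w : tangent x u -> tangent x w ->
  nproj x (u - w) = nproj x u - nproj x w.
Proof. by move=> tu tw; rewrite nprojD ?nprojN //; sm. Qed.
Lemma nproj0 : nproj x 0 = 0.
Proof. by rewrite -[0 in LHS](scale0r 0) nprojZ ?scale0r //; sm. Qed.
Lemma nproj_sum (I : Type) (s : seq I) (u : I -> vec Mt) :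
  (forall i, tangent x (u i)) ->
  nproj x (\sum_(i <- s) u i) = \sum_(i <- s) nproj x (u i).
Proof.
move=> tu; elim: s => [|i s IH]; first by rewrite !big_nil nproj0.
by rewrite !big_cons nprojD ?IH //; sm.
Qed.

Lemma tproj_Et i : tproj x (Et i x) = Et i x.
Proof.
rewrite /tproj (bigD1 i) //= metric_Et // eqxx scale1r big1 ?addr0 // => j ji.
by rewrite metric_Et // eq_sym (negbTE ji) scale0r.
Qed.
Lemma nproj_Et i : nproj x (Et i x) = 0.
Proof. by rewrite /nproj big1 // => l _; rewrite metric_EtN // scale0r. Qed.
Lemma nproj_N l : nproj x (N l x) = N l x.
Proof.
rewrite /nproj (bigD1 l) //= metric_N // eqxx scale1r big1 ?addr0 // => j ji.
by rewrite metric_N // eq_sym (negbTE ji) scale0r.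
Qed.

Lemma tproj_span (c : 'I_n -> R) :
  tproj x (\sum_i c i *: Et i x) = \sum_i c i *: Et i x.
Proof.
rewrite tproj_sum; last by sm.
by apply: eq_bigr => i _; rewrite tprojZ ?tproj_Et //; sm.
Qed.
Lemma nproj_span (c : 'I_n -> R) : nproj x (\sum_i c i *: Et i x) = 0.
Proof.
rewrite nproj_sum; last by sm.
by rewrite big1 // => i _; rewrite nprojZ ?nproj_Et ?scaler0 //; sm.
Qed.
Lemma metric_tproj_Et w i : tangent x w ->
  metric x (tproj x w) (Et i x) = metric x w (Et i x).
Proof.
move=> tw; rewrite -{2}(proj_split Ux tw) (metricDl HDt); try sm.
rewrite [X in _ = _ + X](_ : _ = 0) ?addr0 // /nproj (metric_suml HDt); try sm.
by rewrite big1 // => l _; rewrite (metricZl HDt) ?metric_NEt ?mulr0 //; sm.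
Qed.

Lemma metric_nproj_Et w i : metric x (nproj x w) (Et i x) = 0.
Proof.
rewrite /nproj (metric_suml HDt); try sm.
by rewrite big1 // => l _; rewrite (metricZl HDt) ?metric_NEt ?mulr0 //; sm.
Qed.

Lemma metric_nproj u w : tangent x u -> tangent x w ->
  metric x (nproj x u) w = metric x (nproj x u) (nproj x w).
Proof.
move=> tu tw; rewrite -{1}(proj_split Ux tw) (metricDr HDt); try sm.
rewrite (_ : metric x (nproj x u) (tproj x w) = 0) ?add0r // /tproj.
rewrite (metric_sumr HDt); try sm.
by rewrite big1 // => i _; rewrite (metricZr HDt) ?metric_nproj_Et ?mulr0 //; sm.
Qed.

Lemma metric_nproj_N w l : tangent x w ->
  metric x (nproj x w) (N l x) = metric x w (N l x).
Proof.
move=> tw; rewrite -{2}(proj_split Ux tw) (metricDl HDt); try sm.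
rewrite [X in _ = X + _](_ : _ = 0) ?add0r // /tproj (metric_suml HDt); try sm.
by rewrite big1 // => i _; rewrite (metricZl HDt) ?metric_EtN ?mulr0 //; sm.
Qed.

End Linear.
End Projections.
Arguments tproj {R m n Mt} Et x w.
Arguments nproj {R m k Mt} N x w.

#[local] Hint Resolve smooth_Et smooth_N tangent_Et tangent_N : sm.
#[local] Hint Resolve tangent_tproj tangent_nproj smooth_tproj smooth_nproj : sm.

(** * Fields along an embedded submanifold *)

Section Embedding.
Context {R : realType} {n k m : nat} {Mt : riem R m} {M : riem R n}.
Context {iota : M -> Mt}.
Context {Dt : vfield Mt -> vfield Mt -> vfield Mt}.
Context {D : vfield M -> vfield M -> vfield M}.
Context {E : 'I_n -> vfield M}.
Context {Et : 'I_n -> vfield Mt} {N : 'I_k -> vfield Mt}.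
Context {W : set M} {U : set Mt}.
(** The frames and the extension of E hold on open sets, rather than at one
    point, so that identities between fields can be differentiated. *)
Record adapted : Prop := {
  ad_calct : calculus Dt;
  ad_calc : calculus D;
  ad_emb : riemannian_embedding iota;
  ad_openU : open U;
  ad_openW : open W;
  ad_WU : forall q, W q -> U (iota q);
  ad_framet : forall x, U x -> frame_at (join_frame Et N) x;
  ad_frame : forall q, W q -> frame_at E q;
  ad_ext : forall q i, W q -> Et i (iota q) = push iota q (E i q) }.
Hypothesis ad : adapted.
Let HDt := ad_calct ad.
Let HD := ad_calc ad.
Let emb := ad_emb ad.
Let openU := ad_openU ad.
Let openW := ad_openW ad.
Let WU := ad_WU ad.
Let framet := ad_framet ad.
Let frame := ad_frame ad.
Hint Resolve WU : sm.
Implicit Types (q : M) (X Y Z : vfield Mt) (A B C : vfield M).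
Local Notation tp := (tproj Et).
Local Notation np := (nproj N).

Lemma pushE q u f : smooth f (iota q) -> push iota q u f = u (f \o iota).
Proof. by move=> sf; rewrite /push; case: asboolP. Qed.

Lemma pushP q (a : R) u v : push iota q (a *: u + v) = a *: push iota q u + push iota q v.
Proof.
apply/funext => f; rewrite !fctE /push; case: asboolP => // _.
by rewrite scaler0 addr0.
Qed.
Lemma push0 q : push iota q 0 = 0.
Proof. by apply/funext => f; rewrite /push; case: asboolP. Qed.
Lemma pushD q u v : push iota q (u + v) = push iota q u + push iota q v.
Proof. by have := pushP q 1 u v; rewrite !scale1r. Qed.
Lemma pushZ q a u : push iota q (a *: u) = a *: push iota q u.
Proof. by have := pushP q a u 0; rewrite push0 !addr0. Qed.
Lemma pushN q u : push iota q (- u) = - push iota q u.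
Proof. by rewrite -scaleN1r pushZ scaleN1r. Qed.
Lemma pushB q u v : push iota q (u - v) = push iota q u - push iota q v.
Proof. by rewrite pushD pushN. Qed.
Lemma push_sum (I : Type) (s : seq I) (P : pred I) q (u : I -> vec M) :
  push iota q (\sum_(i <- s | P i) u i) = \sum_(i <- s | P i) push iota q (u i).
Proof. by apply: (big_morph (push iota q)) => [u' v'|]; [exact: pushD|exact: push0]. Qed.

Lemma near_push q (P : Mt -> Prop) : (\forall x \near iota q, P x) ->
  \forall r \near q, P (iota r).
Proof. exact: (emb_continuous emb). Qed.

Lemma tangent_push q u : tangent q u -> tangent (iota q) (push iota q u).
Proof.
have cts := calc_charts HDt.
move=> tu; split.
- move=> f g sf sg fg; rewrite !pushE //.
  apply: (tangent_germ tu (emb_smooth emb sf) (emb_smooth emb sg)).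
  exact: near_push fg.
- move=> a f g sf sg; have sfg : smooth (fun r => a * f r + g r) (iota q) by sm.
  rewrite !pushE //.
  exact: (tangent_linear tu a (emb_smooth emb sf) (emb_smooth emb sg)).
- move=> f g sf sg; have sfg : smooth (fun r => f r * g r) (iota q) by sm.
  rewrite !pushE //.
  exact: (tangent_leibniz tu (emb_smooth emb sf) (emb_smooth emb sg)).
- by move=> f sf; rewrite /push; case: asboolP.
Qed.
Hint Resolve tangent_push : sm.

Lemma push_expand q u : W q -> tangent q u ->
  push iota q u = \sum_i metric q u (E i q) *: Et i (iota q).
Proof.
move=> Wq tu; rewrite {1}(frame_expand HD frame Wq tu) push_sum.
by apply: eq_bigr => i _; rewrite pushZ (ad_ext ad).
Qed.

Lemma tproj_push q u : W q -> tangent q u -> tp (iota q) (push iota q u) = push iota q u.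
Proof. by move=> Wq tu; rewrite push_expand // (tproj_span HDt framet) //; sm. Qed.
Lemma nproj_push q u : W q -> tangent q u -> np (iota q) (push iota q u) = 0.
Proof. by move=> Wq tu; rewrite push_expand // (nproj_span HDt framet) //; sm. Qed.

Lemma metric_push q u v : tangent q u -> tangent q v ->
  metric (iota q) (push iota q u) (push iota q v) = metric q u v.
Proof. by move=> *; rewrite -(emb_induced_metric emb). Qed.

Lemma frame_tangentM q i : W q -> tangent q (E i q).
Proof. by move=> Wq; apply: (frame_tangent frame). Qed.
Lemma frame_smoothM q i : W q -> smooth_field (E i) q.
Proof. by move=> Wq; apply: (frame_smooth frame). Qed.
Hint Resolve frame_tangentM frame_smoothM : sm.

(** The vector with these coefficients is a projection; expanding any other
    projection along E gives the same coefficients. *)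
Lemma tpartE q w : W q -> tangent (iota q) w ->
  tpart iota q w = \sum_i metric (iota q) w (Et i (iota q)) *: E i q.
Proof.
move=> Wq tw; rewrite /tpart; set u := \sum_i _.
have tu : tangent q u by rewrite /u; sm.
have pu : push iota q u = tp (iota q) w.
  rewrite /u push_sum; apply: eq_bigr => i _; by rewrite pushZ (ad_ext ad).
apply: xget_unique => [|u' [tu' pu']].
  split=> // u' tu'; rewrite pu -(tproj_push Wq tu').
  rewrite {1 3}/tproj !(metric_sumr HDt); try sm.
  by apply: eq_bigr => i _; rewrite !(metricZr HDt) ?(metric_tproj_Et HDt framet) //; sm.
apply: (frame_eq HD frame Wq) => // i.
rewrite -!metric_push //; try sm.
by rewrite pu' ?pu -?(ad_ext ad) // ?(metric_tproj_Et HDt framet) //; sm.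
Qed.

Lemma tangent_tpart q w : W q -> tangent (iota q) w -> tangent q (tpart iota q w).
Proof. by move=> Wq tw; rewrite tpartE //; sm. Qed.
Hint Resolve tangent_tpart : sm.

Lemma push_tpart q w : W q -> tangent (iota q) w ->
  push iota q (tpart iota q w) = tp (iota q) w.
Proof.
move=> Wq tw; rewrite tpartE // push_sum; apply: eq_bigr => i _.
by rewrite pushZ (ad_ext ad).
Qed.

Lemma npartE q w : W q -> tangent (iota q) w -> npart iota q w = np (iota q) w.
Proof.
move=> Wq tw; rewrite /npart push_tpart // (tprojE HDt framet) //; last by sm.
by rewrite opprB addrC subrK.
Qed.

(** The ambient field X restricts to the tangent field A along M, near q. *)
Definition lifts (A : vfield M) X q := smooth_field A q /\ extends iota (pushf iota A) X q.

Lemma lifts_near A X q : lifts A X q -> \forall r \near q, lifts A X r.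
Proof.
move=> [/(field_near) sA [/(field_near)/near_push sX XA]].
have XA' : \forall r \near q, \forall r' \near r, X (iota r') = pushf iota A r'.
  exact: near_join XA.
by near=> r; split; [near: r|split; near: r].
Unshelve. all: by end_near. Qed.

Lemma lifts_smooth A X q : lifts A X q -> smooth_field X (iota q).
Proof. by case=> _ []. Qed.
Lemma lifts_smooth0 A X q : lifts A X q -> smooth_field A q.
Proof. by case. Qed.
Hint Resolve lifts_smooth lifts_smooth0 : sm.

Lemma liftsE A X q : lifts A X q -> X (iota q) = push iota q (A q).
Proof. by move=> [_ [_ /nbhs_singleton]]. Qed.

Lemma lifts_E q i : W q -> lifts (E i) (Et i) q.
Proof.
move=> Wq; split; first by sm.
split; first by sm.
by apply: (near_in openW Wq) => r Wr; rewrite (ad_ext ad).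
Qed.

Lemma app_push q u f g : tangent q u -> smooth f (iota q) -> smooth g (iota q) ->
  (\forall r \near q, f (iota r) = g (iota r)) -> push iota q u f = push iota q u g.
Proof.
move=> tu sf sg fg; rewrite !pushE //.
exact: (tangent_germ tu (emb_smooth emb sf) (emb_smooth emb sg)).
Qed.

Lemma app_lifts A X f q : lifts A X q -> smooth f (iota q) ->
  X (iota q) f = A q (f \o iota).
Proof. by move=> lX sf; rewrite (liftsE lX) pushE. Qed.

Lemma metric_lifts A X B Y q : lifts A X q -> lifts B Y q ->
  metric (iota q) (X (iota q)) (Y (iota q)) = metric q (A q) (B q).
Proof. by move=> lX lY; rewrite (liftsE lX) (liftsE lY) metric_push //; sm. Qed.

Lemma app_lifts_metric A X B Y C Z q : lifts A X q -> lifts B Y q ->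
  lifts C Z q ->
  X (iota q) (fun x => metric x (Y x) (Z x)) =
  A q (fun r => metric r (B r) (C r)).
Proof.
move=> lX lY lZ; rewrite (app_lifts lX); last by sm.
symmetry; apply: (app_eq HD); try sm.
near=> r; symmetry; apply: metric_lifts; near: r; exact: lifts_near.
Unshelve. all: by end_near. Qed.

(** Related fields have related brackets. *)
Lemma lie_lifts A X B Y q : lifts A X q -> lifts B Y q ->
  lie X Y (iota q) = push iota q (lie A B q).
Proof.
move=> lX lY; apply/funext => f; rewrite /push; case: asboolP => sf; last first.
  by rewrite /lie; case: asboolP.
have sf0 := emb_smooth emb sf.
have aux A' S B' T : lifts A' S q -> lifts B' T q ->
    S (iota q) (fun x => T x f) = A' q (fun r => B' r (f \o iota)).
  move=> lA lB; rewrite (app_lifts lA); last by sm.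
  symmetry; apply: (app_eq HD); try sm.
  near=> r; symmetry; apply: app_lifts.
    by near: r; exact: lifts_near.
  by near: r; apply: near_push; exact: smooth_near.
by rewrite !lieE // (aux _ _ _ _ lX lY) (aux _ _ _ _ lY lX).
Unshelve. all: by end_near. Qed.

Lemma lifts_lie A X B Y q : lifts A X q -> lifts B Y q ->
  lifts (lie A B) (lie X Y) q.
Proof.
move=> lX lY; split; first by sm.
split; first by sm.
by near=> r; apply: lie_lifts; near: r; exact: lifts_near.
Unshelve. all: by end_near. Qed.

(** The derivative in a direction tangent to M depends only on the values along
    M: in the expansion of Y in the ambient frame, the coefficients of Y and Y'
    agree along M, hence have the same derivatives in that direction. *)
Lemma conn_along X X' Y Y' q u : W q -> tangent q u ->
  smooth_field X (iota q) -> smooth_field X' (iota q) ->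
  X (iota q) = push iota q u -> X' (iota q) = push iota q u ->
  smooth_field Y (iota q) -> smooth_field Y' (iota q) ->
  (\forall r \near q, Y (iota r) = Y' (iota r)) ->
  Dt X Y (iota q) = Dt X' Y' (iota q).
Proof.
move=> Wq tu sX sX' Xu X'u sY sY' YY'.
have Uq := WU Wq.
rewrite (conn_pointwise HDt framet openU Uq sX sX' sY); last by rewrite Xu.
have exp Z : smooth_field Z (iota q) -> Dt X' Z (iota q) =
    \sum_a (push iota q u (fun x => metric x (Z x) (join_frame Et N a x)) *:
         join_frame Et N a (iota q)
      + metric (iota q) (Z (iota q)) (join_frame Et N a (iota q)) *:
         Dt X' (join_frame Et N a) (iota q)).
  move=> sZ; have sF a := frame_smooth framet a Uq.
  rewrite (conn_eqr HDt sX' sZ (field_near_in HDt framet openU Uq sZ)).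
  rewrite (conn_sumr HDt); try sm.
  by apply: eq_bigr => a _; rewrite (connZr HDt) ?X'u //; sm.
rewrite !exp //; apply: eq_bigr => a _; have sF := frame_smooth framet a Uq.
rewrite (nbhs_singleton YY'); congr (_ *: _ + _).
apply: app_push => //; try sm.
by apply: filterS YY' => r ->.
Qed.

(** The Koszul formulas on M and on Mt agree term by term, because metric,
    derivatives and brackets of lifts correspond to each other. *)
Theorem gauss_formula A X B Y q : W q -> lifts A X q -> lifts B Y q ->
  push iota q (D A B q) = tp (iota q) (Dt X Y (iota q)).
Proof.
move=> Wq lX lY; rewrite push_expand //; last by sm.
apply: eq_bigr => i _; congr (_ *: _).
have lE := lifts_E i Wq.
apply: (@pmulrnI _ 2) => //; rewrite (koszul HD); try sm.
rewrite (koszul HDt); try sm.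
rewrite (app_lifts_metric lX lY lE) (app_lifts_metric lY lE lX).
rewrite (app_lifts_metric lE lX lY).
rewrite (metric_lifts (lifts_lie lX lY) lE) (metric_lifts (lifts_lie lY lE) lX).
by rewrite (metric_lifts (lifts_lie lE lX) lY).
Qed.

(** Covariant derivatives of lifted fields are lifted by an explicit formula,
    so that second derivatives on M can be computed in the ambient manifold. *)
Lemma lifts_conn A X B Y q : W q -> lifts A X q -> lifts B Y q ->
  lifts (D A B) (fun x => tp x (Dt X Y x)) q.
Proof.
move=> Wq lX lY; split; first by sm.
split; first by sm.
near=> r; rewrite /pushf (gauss_formula (X := X) (Y := Y)) //; near: r.
- exact: (near_in openW Wq).
- exact: lifts_near.
- exact: lifts_near.
Unshelve. all: by end_near. Qed.

(** The value is the same for all extensions, by [conn_along]. *)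
Lemma dalongE A X eta etat q : W q -> lifts A X q -> extends iota eta etat q ->
  dalong iota Dt A eta q = Dt X etat (iota q).
Proof.
move=> Wq lX [sYt YYt]; apply: xget_unique.
  by exists X, etat; split=> //; case: lX.
move=> _ [X' [Y' [[sX' XX'] [sY' YY'] ->]]].
apply: (@conn_along _ _ _ _ _ (A q)) => //; try sm.
- exact: nbhs_singleton XX'.
- exact: liftsE.
- by apply: filterS2 YYt YY' => r -> ->.
Qed.

Lemma second_formE A X B Y q : W q -> lifts A X q -> lifts B Y q ->
  second_form iota Dt A B q = np (iota q) (Dt X Y (iota q)).
Proof.
move=> Wq lX lY; rewrite /second_form (dalongE Wq lX (proj2 lY)) npartE //.
by sm.
Qed.

Lemma extends_second_form A X B Y q : W q -> lifts A X q -> lifts B Y q ->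
  extends iota (second_form iota Dt A B) (fun x => np x (Dt X Y x)) q.
Proof.
move=> Wq lX lY; split; first by sm.
near=> r; symmetry; apply: second_formE; near: r.
- exact: (near_in openW Wq).
- exact: lifts_near.
- exact: lifts_near.
Unshelve. all: by end_near. Qed.

Lemma nconnE A X eta etat q : W q -> lifts A X q -> extends iota eta etat q ->
  nconn iota Dt A eta q = np (iota q) (Dt X etat (iota q)).
Proof.
by move=> Wq lX le; rewrite /nconn (dalongE Wq lX le) npartE //; case: le; sm.
Qed.

Lemma weingartenE A X eta etat q : W q -> lifts A X q -> extends iota eta etat q ->
  push iota q (weingarten iota Dt eta A q) = - tp (iota q) (Dt X etat (iota q)).
Proof.
move=> Wq lX le; rewrite /weingarten (dalongE Wq lX le) pushN push_tpart //.
by case: le; sm.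
Qed.

Lemma nablaB_second_formE A X B Y C Z q : W q -> lifts A X q ->
  lifts B Y q -> lifts C Z q ->
  nablaB iota Dt D (second_form iota Dt) A B C q =
    np (iota q) (Dt X (fun x => np x (Dt Y Z x)) (iota q))
    - np (iota q) (Dt (fun x => tp x (Dt X Y x)) Z (iota q))
    - np (iota q) (Dt Y (fun x => tp x (Dt X Z x)) (iota q)).
Proof.
move=> Wq lX lY lZ; rewrite /nablaB.
rewrite (nconnE Wq lX (extends_second_form Wq lY lZ)).
rewrite (second_formE Wq (lifts_conn Wq lX lY) lZ).
by rewrite (second_formE Wq lY (lifts_conn Wq lX lZ)).
Qed.

(** The difference is the normal part of the bracket [X, Y], which is tangent to
    M. *)
Lemma second_form_sym A X B Y q : W q -> lifts A X q -> lifts B Y q ->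
  np (iota q) (Dt X Y (iota q)) = np (iota q) (Dt Y X (iota q)).
Proof.
move=> Wq lX lY; have Uq := WU Wq.
have sX := lifts_smooth lX; have sY := lifts_smooth lY.
apply/eqP; rewrite -subr_eq0 -(nprojB HDt framet Uq).
- by rewrite (conn_torsion HDt) // (lie_lifts lX lY) nproj_push //; sm.
- by sm.
- by sm.
Qed.

End Embedding.

Arguments lifts {R n m Mt M} iota A X q.

#[local] Hint Resolve tangent_push lifts_smooth lifts_smooth0 : sm.

(** * The equations of Gauss and Codazzi *)

Section GaussCodazzi.
Context {R : realType} {n k m : nat} {Mt : riem R m} {M : riem R n}.
Context {iota : M -> Mt}.
Context {Dt : vfield Mt -> vfield Mt -> vfield Mt}.
Context {D : vfield M -> vfield M -> vfield M}.
Context {E : 'I_n -> vfield M}.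
Context {Et : 'I_n -> vfield Mt} {N : 'I_k -> vfield Mt}.
Context {W : set M} {U : set Mt}.
Hypothesis ad : @adapted R n k m Mt M iota Dt D E Et N W U.
Let HDt := ad_calct ad.
Let HD := ad_calc ad.
Let openU := ad_openU ad.
Let openW := ad_openW ad.
Let framet := ad_framet ad.
Let frame := ad_frame ad.
Context {p : M}.
Hypothesis Wp : W p.
Let Up : U (iota p) := ad_WU ad Wp.
Implicit Types (q : M) (X Y Z V : vfield Mt) (A B C S : vfield M).
Local Notation tp := (tproj Et).
Local Notation np := (nproj N).
Local Notation x := (iota p).
Local Notation lift A X := (lifts iota A X p).
Local Notation "'II' X Y" := (fun y => np y (Dt X Y y))
  (at level 10, X at level 9, Y at level 9).
Local Notation "'TT' X Y" := (fun y => tp y (Dt X Y y))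
  (at level 10, X at level 9, Y at level 9).

Lemma smooth_II X Y : smooth_field X x -> smooth_field Y x ->
  smooth_field (II X Y) x.
Proof. by move=> sX sY; apply: (smooth_nproj HDt framet) => //; sm. Qed.
Lemma smooth_TT X Y : smooth_field X x -> smooth_field Y x ->
  smooth_field (TT X Y) x.
Proof. by move=> sX sY; apply: (smooth_tproj HDt framet) => //; sm. Qed.
Hint Resolve smooth_II smooth_TT : sm.

Let nearU : \forall y \near x, U y := near_in openU Up (fun _ => id).
Let nearW : \forall r \near p, W r := near_in openW Wp (fun _ => id).

Lemma conn_split X Y V : smooth_field X x -> smooth_field Y x -> smooth_field V x ->
  Dt V (Dt X Y) x = Dt V (TT X Y) x + Dt V (II X Y) x.
Proof.
move=> sX sY sV.
have sXY : smooth_field (Dt X Y) x by sm.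
have sT := smooth_TT sX sY; have sI := smooth_II sX sY.
rewrite -(connDr HDt) //; apply: (conn_eqr HDt) => //.
apply: filterS2 nearU (field_near sXY) => y Uy sy.
by rewrite (proj_split HDt framet) //; exact: field_tangent.
Qed.

Lemma conn_splitl X Y V : smooth_field X x -> smooth_field Y x -> smooth_field V x ->
  Dt (Dt X Y) V x = Dt (TT X Y) V x + Dt (II X Y) V x.
Proof.
move=> sX sY sV.
have sXY : smooth_field (Dt X Y) x by sm.
have sT := smooth_TT sX sY; have sI := smooth_II sX sY.
have sTI : smooth_field (fun y => tp y (Dt X Y y) + np y (Dt X Y y)) x by sm.
rewrite -(connDl HDt) //; apply: (conn_pointwise HDt framet) => //.
by rewrite (proj_split HDt framet) //; exact: field_tangent.
Qed.

(** The function g(np V, Y) vanishes along M, hence so does its derivative along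
    X. *)
Lemma metric_conn_normal A X B Y V : lift A X -> lift B Y -> smooth_field V x ->
  metric x (Dt X (fun y => np y (V y)) x) (Y x) =
  - metric x (np x (V x)) (np x (Dt X Y x)).
Proof.
move=> lX lY sV; have sX := lifts_smooth lX; have sY := lifts_smooth lY.
have snV : smooth_field (fun y => np y (V y)) x by apply: (smooth_nproj HDt framet).
have tV := field_tangent sV.
have tXY : tangent x (Dt X Y x) by sm.
rewrite -(metric_nproj HDt framet Up tV tXY).
apply/eqP; rewrite -addr_eq0 -(app_metric HDt) //; apply/eqP.
have sf : smooth (fun y => metric y (np y (V y)) (Y y)) x by sm.
rewrite (liftsE lX) (app_push ad (g := fun=> 0) (field_tangent (lifts_smooth0 lX)) sf).
- exact: tangent_cst (tangent_push ad (field_tangent (lifts_smooth0 lX))).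
- by sm.
have := lifts_near ad lY.
have sVn := near_push ad (field_near sV).
apply: filterS3 sVn nearW => r sr Wr lr.
have Ur := ad_WU ad Wr.
have tr := field_tangent sr.
have ty := field_tangent (lifts_smooth lr).
rewrite (metric_nproj HDt framet Ur tr ty) (liftsE lr).
rewrite (nproj_push ad Wr (field_tangent (lifts_smooth0 lr))).
have tn := tangent_nproj framet (V (iota r)) Ur.
by rewrite (metricC HDt) ?(metric0l HDt) //; exact: tangent0.
Qed.

Lemma metric_conn_tangent A X B Y V : lift A X -> lift B Y -> smooth_field V x ->
  metric x (Dt X (fun y => tp y (V y)) x) (Y x) =
  metric x (Dt X V x) (Y x) + metric x (np x (V x)) (np x (Dt X Y x)).
Proof.
move=> lX lY sV; have sX := lifts_smooth lX; have sY := lifts_smooth lY.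
have snV : smooth_field (fun y => np y (V y)) x by apply: (smooth_nproj HDt framet).
have stV : smooth_field (fun y => tp y (V y)) x by apply: (smooth_tproj HDt framet).
rewrite (conn_eqr HDt (Y := V) (Y' := fun y => tp y (V y) + np y (V y))) //.
  rewrite (connDr HDt) // (metricDl HDt); try sm.
  by rewrite (metric_conn_normal lX lY sV) addrNK.
apply: filterS2 nearU (field_near sV) => y Uy sy.
by rewrite (proj_split HDt framet) //; exact: field_tangent.
Qed.

(** Projecting the inner derivative in D_X D_Y Z to M drops its normal part;
    by [metric_conn_tangent] this costs a product of second fundamental forms. *)
Theorem gauss_equation A X B Y C Z S V : lift A X -> lift B Y -> lift C Z ->
  lift S V ->
  curv4 D A B C S p = curv4 Dt X Y Z V x
    + metric x (np x (Dt Y Z x)) (np x (Dt X V x))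
    - metric x (np x (Dt X Z x)) (np x (Dt Y V x)).
Proof.
move=> lX lY lZ lV.
have [sX sY] := (lifts_smooth lX, lifts_smooth lY).
have [sZ sV] := (lifts_smooth lZ, lifts_smooth lV).
have [sX0 sY0] := (lifts_smooth0 lX, lifts_smooth0 lY).
have [sZ0 sV0] := (lifts_smooth0 lZ, lifts_smooth0 lV).
have sYZ : smooth_field (Dt Y Z) x by sm.
have sXZ : smooth_field (Dt X Z) x by sm.
rewrite /curv4 -(metric_push ad); try sm.
rewrite -(liftsE lV) /curv !pushB.
rewrite (gauss_formula ad Wp lX (lifts_conn ad Wp lY lZ)).
rewrite (gauss_formula ad Wp lY (lifts_conn ad Wp lX lZ)).
rewrite (gauss_formula ad Wp (lifts_lie ad lX lY) lZ).
have [sT1 sT2] := (smooth_TT sY sZ, smooth_TT sX sZ).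
have tV : tangent x (V x) by sm.
have tt u := tangent_tproj framet u Up.
have tE i := tangent_Et framet i Up.
have tpV u : tangent x u -> metric x (tp x u) (V x) = metric x u (V x).
  move=> tu; rewrite (liftsE lV) (push_expand ad Wp (field_tangent sV0)).
  rewrite !(metric_sumr HDt) //; try sm.
  apply: eq_bigr => i _; rewrite !(metricZr HDt) ?(metric_tproj_Et HDt framet) //.
rewrite !(metricBl HDt) //; try sm.
rewrite !tpV; try sm.
rewrite (metric_conn_tangent lX lV sYZ) (metric_conn_tangent lY lV sXZ).
ring.
Qed.

(** The fields II Y Z and II Z Y agree along M, so their derivatives along X
    agree too. *)
Lemma nablaB_sym A X B Y C Z : lift A X -> lift B Y -> lift C Z ->
  nablaB iota Dt D (second_form iota Dt) A B C p =
  nablaB iota Dt D (second_form iota Dt) A C B p.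
Proof.
move=> lX lY lZ.
rewrite (nablaB_second_formE ad Wp lX lY lZ) (nablaB_second_formE ad Wp lX lZ lY).
have [sX sY] := (lifts_smooth lX, lifts_smooth lY); have sZ := lifts_smooth lZ.
rewrite (second_form_sym ad Wp (lifts_conn ad Wp lX lY) lZ).
rewrite (second_form_sym ad Wp lY (lifts_conn ad Wp lX lZ)).
rewrite -!addrA; congr (np x _ + _); last by rewrite addrC.
apply: (conn_along ad Wp (field_tangent (lifts_smooth0 lX)) sX sX (liftsE lX) (liftsE lX)).
- exact: smooth_II.
- exact: smooth_II.
apply: filterS3 nearW (lifts_near ad lY) (lifts_near ad lZ) => r Wr lYr lZr.
exact: (second_form_sym ad Wr lYr lZr).
Qed.

(** Splitting the inner derivatives into tangential and normal parts, and
    replacing [X, Y] by the tangential parts of D_X Y - D_Y X, gives all six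
    terms of the two derivatives of the second fundamental form. *)
Theorem codazzi_equation A X B Y C Z : lift A X -> lift B Y -> lift C Z ->
  np x (curv Dt X Y Z x) =
  nablaB iota Dt D (second_form iota Dt) A B C p
  - nablaB iota Dt D (second_form iota Dt) B A C p.
Proof.
move=> lX lY lZ.
rewrite (nablaB_second_formE ad Wp lX lY lZ) (nablaB_second_formE ad Wp lY lX lZ).
have [sX sY] := (lifts_smooth lX, lifts_smooth lY); have sZ := lifts_smooth lZ.
have tX := field_tangent (lifts_smooth0 lX); have tY := field_tangent (lifts_smooth0 lY).
have [sYZ sXZ] := (smooth_TT sY sZ, smooth_TT sX sZ).
have [iYZ iXZ] := (smooth_II sY sZ, smooth_II sX sZ).
have [sXY sYX] := (smooth_TT sX sY, smooth_TT sY sX).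
rewrite /curv !(nprojB HDt framet Up); try sm.
rewrite (conn_split sY sZ sX) (conn_split sX sZ sY) !(nprojD HDt framet Up); try sm.
have -> : Dt (lie X Y) Z x = Dt (TT X Y) Z x - Dt (TT Y X) Z x.
  have sB : smooth_field (fun y => tp y (Dt X Y y) - tp y (Dt Y X y)) x by sm.
  rewrite -(connBl HDt) //; apply: (conn_pointwise HDt framet openU Up) => //; first by sm.
  rewrite -(tprojB HDt framet Up); try sm.
  rewrite (conn_torsion HDt) // (lie_lifts ad lX lY) (tproj_push ad) //; sm.
rewrite (nprojB HDt framet Up); try sm.
vring.
Qed.

(** * Laplacians on M and on the ambient manifold *)

Section Trace.
Context {v : vfield M} {vt : vfield Mt}.
Hypothesis lv : lift v vt.
Let lE i := lifts_E ad i Wp.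
Let sE i : smooth_field (Et i) x := smooth_Et framet i Up.
Let sv : smooth_field vt x := lifts_smooth lv.
Let tE0 i : tangent p (E i p) := field_tangent (lifts_smooth0 (lE i)).
Let tv0 : tangent p (v p) := field_tangent (lifts_smooth0 lv).
Local Notation F := (join_frame Et N).

Lemma push_bochner : push iota p (bochner D E v p) =
  - \sum_i (tp x (Dt (Et i) (TT (Et i) vt) x) - tp x (Dt (TT (Et i) (Et i)) vt x)).
Proof.
rewrite /bochner pushN push_sum; congr (- _); apply: eq_bigr => i _; rewrite pushB.
rewrite (gauss_formula ad Wp (lE i) (lifts_conn ad Wp (lE i) lv)).
by rewrite (gauss_formula ad Wp (lifts_conn ad Wp (lE i) (lE i)) lv).
Qed.

Lemma tr_nablaBE : tr_nablaB_II iota Dt D E v p =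
  \sum_i (np x (Dt (Et i) (II (Et i) vt) x) - np x (Dt (TT (Et i) (Et i)) vt x)
    - np x (Dt (Et i) (TT (Et i) vt) x)).
Proof.
by apply: eq_bigr => i _; rewrite (nablaB_second_formE ad Wp (lE i) (lE i) lv).
Qed.

Lemma second_form_connE j : second_form iota Dt (E j) (D (E j) v) p =
  np x (Dt (Et j) (TT (Et j) vt) x).
Proof. by rewrite (second_formE ad Wp (lE j) (lifts_conn ad Wp (lE j) lv)). Qed.

(** Along M this is n times the mean curvature vector. *)
Definition tr_II : vfield Mt := fun y => \sum_j np y (Dt (Et j) (Et j) y).

Lemma smooth_tr_II : smooth_field tr_II x.
Proof.
by apply: (field_sum HDt) => j; exact: smooth_II.
Qed.

Lemma extends_tr_II :
  extends iota (mean_curv_vec iota Dt E) (fun y => n%:R^-1 *: tr_II y) p.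
Proof.
split; first by apply: (field_scale HDt); exact: smooth_tr_II.
have lEn : \forall r \near p, forall i, lifts iota (E i) (Et i) r.
  by apply: filter_forall => i; exact: (lifts_near ad (lE i)).
apply: filterS2 nearW lEn => r Wr lr; rewrite /mean_curv_vec /tr_II.
congr (_ *: _); apply: eq_bigr => i _.
by rewrite (second_formE ad Wr (lr i) (lr i)).
Qed.

Section MeanCurvature.
Context {Ht : vfield Mt}.
Hypothesis n_gt0 : (0 < n)%N.
Hypothesis eH : extends iota (mean_curv_vec iota Dt E) Ht p.

Lemma mean_near : \forall r \near p, n%:R *: Ht (iota r) = tr_II (iota r).
Proof.
have [_ e1] := extends_tr_II; have [_ e2] := eH.
apply: filterS2 e1 e2 => r <- ->; rewrite scalerA divff ?scale1r //.
by rewrite pnatr_eq0 -lt0n.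
Qed.

Lemma mean_conn_l : n%:R *: Dt Ht vt x = \sum_j Dt (II (Et j) (Et j)) vt x.
Proof.
have [sH _] := eH.
rewrite -(connZl HDt (f := fun=> n%:R)) //; last by sm.
rewrite -(conn_suml HDt) //; last by move=> j; exact: smooth_II.
apply: (conn_pointwise HDt framet openU Up) => //.
- by apply: (field_scale HDt).
- exact: smooth_tr_II.
- exact: nbhs_singleton mean_near.
Qed.

(** An arbitrary extension of the mean curvature vector may be replaced by this
    one, since X is tangent to M. *)
Lemma mean_conn_r A X : lift A X ->
  n%:R *: Dt X Ht x = \sum_j Dt X (II (Et j) (Et j)) x.
Proof.
move=> lX; have sX := lifts_smooth lX; have [sH _] := eH.
rewrite -(conn_scaler HDt) // -(conn_sumr HDt) //; last by move=> j; exact: smooth_II.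
apply: (conn_along ad Wp (field_tangent (lifts_smooth0 lX)) sX sX (liftsE lX) (liftsE lX)).
- by apply: (field_scale HDt).
- exact: smooth_tr_II.
- exact: mean_near.
Qed.

Lemma push_weingarten_mean :
  n%:R *: push iota p (weingarten iota Dt (mean_curv_vec iota Dt E) v p) =
  - \sum_j tp x (Dt vt (II (Et j) (Et j)) x).
Proof.
have [sH _] := eH; have tD X Y : smooth_field X x -> smooth_field Y x -> tangent x (Dt X Y x).
  by move=> sX sY; sm.
have sI j := smooth_II (sE j) (sE j).
rewrite (weingartenE ad Wp lv eH) scalerN -(tprojZ HDt framet Up); last exact: tD.
rewrite (mean_conn_r lv) (tproj_sum HDt framet Up) // => j; exact: tD.
Qed.

(** The Codazzi equation for (E_j, v, E_j), summed over j. The derivatives of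
    E_j along v that appear in the derivative of the trace cancel, being a
    contraction of a skew family with a symmetric one. *)
Lemma tr_nablaB_codazzi : tr_nablaB_II iota Dt D E v p =
  n%:R *: np x (Dt vt Ht x) + \sum_j np x (curv Dt (Et j) vt (Et j) x).
Proof.
have [sH _] := eH; have tD X Y : smooth_field X x -> smooth_field Y x -> tangent x (Dt X Y x).
  by move=> sX sY; sm.
have sI j := smooth_II (sE j) (sE j).
rewrite -(nprojZ HDt framet Up); last exact: tD.
rewrite (mean_conn_r lv) (nproj_sum HDt framet Up); last by move=> j; exact: tD.
(* Expand D_v E_j along E: its coefficients are skew in (i, j). *)
have skew0 : \sum_j np x (Dt (TT vt (Et j)) (Et j) x) = 0.
  rewrite -[RHS](@skew_sym_sum0 R 'I_n (vec Mt)
    (fun j i => metric x (Dt vt (Et j) x) (Et i x))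
    (fun j i => np x (Dt (Et i) (Et j) x))); first last.
  - by move=> a b; exact: (second_form_sym ad Wp (lE b) (lE a)).
  - by move=> a b; exact: (frame_conn_skew HDt framet openU (inl a) (inl b) Up sv).
  apply: eq_bigr => j _; rewrite /tproj (conn_suml HDt) //; last by sm.
  rewrite (nproj_sum HDt framet Up); last by move=> i; apply: tD => //; sm.
  apply: eq_bigr => i _; rewrite (connZl HDt) ?(nprojZ HDt framet Up) //; first exact: tD.
  by sm.
(* The last two terms of the derivative of II agree by symmetry of II. *)
have per j : nablaB iota Dt D (second_form iota Dt) (E j) (E j) v p =
    np x (Dt vt (II (Et j) (Et j)) x) + np x (curv Dt (Et j) vt (Et j) x)
    - np x (Dt (TT vt (Et j)) (Et j) x) *+ 2.
  rewrite (nablaB_sym (lE j) (lE j) lv) (codazzi_equation (lE j) lv (lE j)).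
  rewrite (nablaB_second_formE ad Wp lv (lE j) (lE j)).
  rewrite -(second_form_sym ad Wp (lifts_conn ad Wp lv (lE j)) (lE j)).
  rewrite mulr2n; vring.
rewrite /tr_nablaB_II (eq_bigr _ (fun j _ => per j)) sumrB big_split /=.
by rewrite sumrMnl skew0 mul0rn subr0.
Qed.

Lemma bochner_ambient : bochner Dt F vt x =
  - \sum_j (Dt (Et j) (Dt (Et j) vt) x - Dt (Dt (Et j) (Et j)) vt x)
  - \sum_l Dt (N l) (Dt (N l) vt) x + \sum_l Dt (Dt (N l) (N l)) vt x.
Proof.
by rewrite /bochner big_sumType /= opprD -addrA; congr (_ + _); rewrite sumrB opprB addrC.
Qed.

Lemma metric_ric_op_Et i : metric x (ric_op Dt F vt x) (Et i x) = ric Dt F vt (Et i) x.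
Proof.
exact: (metric_frame_sum HDt framet (fun a => ric Dt F vt (F a) x) (inl i) Up).
Qed.

Lemma tangent_ric_op : tangent x (ric_op Dt F vt x).
Proof.
by apply: tangent_sum => a; apply: tangentZ; exact: (frame_tangent framet).
Qed.

(** The Gauss equation for (E_j, v, E_i, E_j), summed over j: the products of
    second fundamental forms are the tangential derivatives of normal fields,
    and the ambient Ricci curvature has additional terms in the normal
    directions. *)
Lemma tangential_ricci :
  \sum_j tp x (Dt (Et j) (II (Et j) vt) x) + tp x (ric_op Dt F vt x)
  + n%:R *: push iota p (weingarten iota Dt (mean_curv_vec iota Dt E) v p) =
  push iota p (ric_op D E v p)
  + \sum_l \sum_j curv4 Dt (N l) (Et j) vt (N l) x *: Et j x.
Proof.
have tD X Y : smooth_field X x -> smooth_field Y x -> tangent x (Dt X Y x).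
  by move=> sX sY; sm.
have sI j := smooth_II (sE j) (sE j); have sIv j := smooth_II (sE j) sv.
have sN l := smooth_N framet l Up.
rewrite push_weingarten_mean.
rewrite -(tproj_sum HDt framet Up); last by move=> j; exact: tD.
rewrite -(tproj_sum HDt framet Up); last by move=> j; exact: tD.
rewrite exchange_big [ric_op D E v p]/ric_op push_sum /=.
rewrite -sumrN /tproj -!big_split /=; apply: eq_bigr => i _.
rewrite pushZ -(ad_ext ad) // -scaler_suml -!scalerDl -scaleNr -scalerDl.
congr (_ *: _).
rewrite metric_ric_op_Et !(metric_suml HDt); try sm.
rewrite /ric big_sumType /=.
rewrite addrA [LHS]addrAC; congr (_ + _); last first.
  apply: eq_bigr => l _; rewrite (curv4_pair HDt) //.
  rewrite /curv4 (curvC HDt) // (metricNl HDt); try sm.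
  by rewrite (curv_skew HDt) // opprK.
rewrite -sumrN -!big_split /=; apply: eq_bigr => j _.
rewrite (gauss_equation (lE j) lv (lE i) (lE j)).
rewrite (metric_conn_normal (lE j) (lE i)); [|by sm].
rewrite (metric_conn_normal lv (lE i)); [|by sm].
rewrite (second_form_sym ad Wp (lE j) lv).
have tn X Y : tangent x (np x (Dt X Y x)) by exact: (tangent_nproj framet).
rewrite (metricC HDt (tn (Et j) (Et j))) ?(metricC HDt (tn vt (Et j))) //.
ring.
Qed.


(** In the tangential part of the ambient Laplacian each covariant derivative
    is split into its tangential and normal parts. The purely tangential terms
    are the Laplacian of M; the mixed ones are the derivative of the second
    fundamental form and twice II(E_j, D_{E_j} v); the tangential derivatives of
    normal fields are accounted for by [tangential_ricci]. *)
Theorem laplacian_weingarten :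
  bochner Dt F vt x - ric_op Dt F vt x =
    push iota p (bochner D E v p - ric_op D E v p)
    + n%:R *: push iota p (weingarten iota Dt (mean_curv_vec iota Dt E) v p)
    + n%:R *: Dt Ht vt x
    - \sum_l Dt (N l) (Dt (N l) vt) x
    + \sum_l Dt (Dt (N l) (N l)) vt x
    - \sum_l \sum_j curv4 Dt (N l) (Et j) vt (N l) x *: Et j x
    - tr_nablaB_II iota Dt D E v p
    - 2 *: \sum_j second_form iota Dt (E j) (D (E j) v) p
    - npart iota p (ric_op Dt F vt x).
Proof.
have tD X Y : smooth_field X x -> smooth_field Y x -> tangent x (Dt X Y x).
  by move=> sX sY; sm.
have tric := tangent_ric_op.
(* The part of the ambient Laplacian along M. *)
have main : \sum_j (Dt (Et j) (Dt (Et j) vt) x - Dt (Dt (Et j) (Et j)) vt x) =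
    - push iota p (bochner D E v p) + tr_nablaB_II iota Dt D E v p
    + 2 *: (\sum_j second_form iota Dt (E j) (D (E j) v) p)
    - n%:R *: Dt Ht vt x + \sum_j tp x (Dt (Et j) (II (Et j) vt) x).
  rewrite push_bochner opprK tr_nablaBE mean_conn_l scaler_sumr -sumrN -!big_split /=.
  apply: eq_bigr => j _; rewrite second_form_connE.
  have sT := smooth_TT (sE j) sv; have sI := smooth_II (sE j) sv.
  have sTE := smooth_TT (sE j) (sE j); have sIE := smooth_II (sE j) (sE j).
  rewrite conn_split // conn_splitl //.
  have split w : tangent x w -> w = tp x w + np x w.
    by move=> tw; rewrite (proj_split HDt framet).
  rewrite [in LHS](split (Dt (Et j) (TT (Et j) vt) x)); last exact: tD.
  rewrite [in LHS](split (Dt (Et j) (II (Et j) vt) x)); last exact: tD.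
  rewrite [in LHS](split (Dt (TT (Et j) (Et j)) vt x)); last exact: tD.
  vring.
rewrite bochner_ambient main (npartE ad Wp tric) pushB.
rewrite -{1}(proj_split HDt framet Up tric).
have -> : n%:R *: push iota p (weingarten iota Dt (mean_curv_vec iota Dt E) v p) =
    push iota p (ric_op D E v p)
    + \sum_l \sum_j curv4 Dt (N l) (Et j) vt (N l) x *: Et j x
    - (\sum_j tp x (Dt (Et j) (II (Et j) vt) x) + tp x (ric_op Dt F vt x)).
  by rewrite -tangential_ricci addrC addrA addNr add0r.
set a1 := push _ _ _; set a2 := tr_nablaB_II _ _ _ _ _ _; set a3 := \sum_(j < n) second_form _ _ _ _ _.
set a4 := Dt Ht vt x; set a5 := \sum_(j < n) tp _ _; set a6 := \sum_(l < k) Dt _ _ _.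
set a7 := \sum_(l < k) Dt (Dt _ _) _ _; set a8 := push _ _ _; set a9 := \sum_(l < k) \sum_(j < n) _.
set a10 := tp _ _; set a11 := np _ _.
clearbody a1 a2 a3 a4 a5 a6 a7 a8 a9 a10 a11.
vring.
Qed.

(** The term n W_H v + n D_H v differs from n [H, v] by the normal derivative of
    H along v, which the contracted Codazzi equation exchanges for the trace of
    the derivative of II. *)
Theorem laplacian_lie :
  bochner Dt F vt x - ric_op Dt F vt x =
    push iota p (bochner D E v p - ric_op D E v p)
    + n%:R *: lie Ht vt x
    - \sum_l Dt (N l) (Dt (N l) vt) x
    + \sum_l Dt (Dt (N l) (N l)) vt x
    - \sum_l \sum_j curv4 Dt (N l) (Et j) vt (N l) x *: Et j x
    - 2 *: \sum_j second_form iota Dt (E j) (D (E j) v) p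
    - \sum_j npart iota p (curv Dt (Et j) vt (Et j) x)
    - npart iota p (ric_op Dt F vt x).
Proof.
have [sH _] := eH.
have tD X Y : smooth_field X x -> smooth_field Y x -> tangent x (Dt X Y x).
  by move=> sX sY; sm.
rewrite laplacian_weingarten tr_nablaB_codazzi -(conn_torsion HDt) // scalerBr.
have -> : n%:R *: push iota p (weingarten iota Dt (mean_curv_vec iota Dt E) v p) =
    - (n%:R *: tp x (Dt vt Ht x)).
  by rewrite (weingartenE ad Wp lv eH) scalerN.
have split : Dt vt Ht x = tp x (Dt vt Ht x) + np x (Dt vt Ht x).
  by rewrite (proj_split HDt framet) //; exact: tD.
rewrite {3}split scalerDr.
have eN j : npart iota p (curv Dt (Et j) vt (Et j) x) = np x (curv Dt (Et j) vt (Et j) x).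
  by rewrite (npartE ad Wp) //; sm.
rewrite [in RHS](eq_bigr _ (fun j _ => eN j)).
vring.
Qed.

End MeanCurvature.
End Trace.

End GaussCodazzi.

(** * Hypersurfaces *)

Section Hypersurface.
Context {R : realType} {n m : nat} {Mt : riem R m} {M : riem R n}.
Context {iota : M -> Mt}.
Context {Dt : vfield Mt -> vfield Mt -> vfield Mt}.
Context {D : vfield M -> vfield M -> vfield M}.
Context {E : 'I_n -> vfield M}.
Context {Et : 'I_n -> vfield Mt} {N : vfield Mt}.
Context {W : set M} {U : set Mt}.
Local Notation N1 := (fun _ : 'I_1 => N).
Hypothesis ad : @adapted R n 1 m Mt M iota Dt D E Et N1 W U.
Let HDt := ad_calct ad.
Let HD := ad_calc ad.
Let openU := ad_openU ad.
Let openW := ad_openW ad.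
Let framet := ad_framet ad.
Let frame := ad_frame ad.
Implicit Types (q r : M) (X Y Z V : vfield Mt) (A B C S : vfield M).
Local Notation tp := (tproj Et).
Local Notation np := (nproj N1).
Local Notation F := (join_frame Et N1).

Lemma normal_smooth y : U y -> smooth_field N y.
Proof. exact: (smooth_N framet ord0). Qed.
Lemma normal_tangent y : U y -> tangent y (N y).
Proof. exact: (tangent_N framet ord0). Qed.
Hint Resolve normal_smooth normal_tangent : sm.

Lemma nprojE y w : np y w = metric y w (N y) *: N y.
Proof. by rewrite /nproj big_ord1. Qed.

(** The length of N is constant. *)
Lemma metric_conn_NN X y : U y -> smooth_field X y -> metric y (Dt X N y) (N y) = 0.
Proof.
move=> Uy sX.
have := frame_conn_skew HDt framet openU (inr ord0) (inr ord0) Uy sX.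
move=> /eqP; rewrite -addr_eq0 -mulr2n mulrn_eq0 /=.
by move/eqP.
Qed.

Lemma near_nproj_N y : U y -> \forall z \near y, np z (N z) = N z.
Proof.
move=> Uy; apply: (near_in openU Uy) => z Uz.
exact: (nproj_N framet Uz ord0).
Qed.

(** Differentiating g(N, Y) = 0 along M. *)
Lemma shape_second_form A X B Y q : W q -> lifts iota A X q -> lifts iota B Y q ->
  metric q (shape_op iota Dt N A q) (B q) =
  metric (iota q) (Dt X Y (iota q)) (N (iota q)).
Proof.
move=> Wq lX lY; have Uq := ad_WU ad Wq.
have [sX sY] := (lifts_smooth lX, lifts_smooth lY).
have sN := normal_smooth Uq.
have eN : extends iota (N \o iota) N q by split=> //; apply: filterE.
have tw : tangent q (shape_op iota Dt N A q).
  rewrite /shape_op /weingarten (dalongE ad Wq lX eN).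
  by apply: tangentN; apply: (tangent_tpart ad); sm.
have tY := field_tangent (lifts_smooth0 lY).
rewrite -(metric_push ad) // (weingartenE ad Wq lX eN) -(liftsE lY).
have tN : tangent (iota q) (Dt X N (iota q)) by sm.
have tt := tangent_tproj framet (Dt X N (iota q)) Uq.
rewrite (metricNl HDt) //; last by sm.
have -> : metric (iota q) (tp (iota q) (Dt X N (iota q))) (Y (iota q)) =
    metric (iota q) (Dt X N (iota q)) (Y (iota q)).
  rewrite (liftsE lY) (push_expand ad Wq tY).
  rewrite !(metric_sumr HDt) //; try sm.
  apply: eq_bigr => i _.
  by rewrite !(metricZr HDt) ?(metric_tproj_Et HDt framet) //; sm.
rewrite (conn_eqr HDt (Y := N) (Y' := fun y => np y (N y))) //; last first.
  by apply: filterS (near_nproj_N Uq) => z ->.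
rewrite (metric_conn_normal ad Wq lX lY) // opprK.
rewrite (nproj_N framet Uq ord0) (metricC HDt); try sm.
  by rewrite (metric_nproj_N HDt framet Uq ord0); sm.
Qed.

(** A smooth extension of the mean curvature to the ambient manifold, which
    makes the multiple of N by it an extension of the mean curvature vector. *)
Definition mean_ext : Mt -> R :=
  fun y => n%:R^-1 * \sum_j metric y (Dt (Et j) (Et j) y) (N y).

Lemma smooth_mean_ext y : U y -> smooth mean_ext y.
Proof.
move=> Uy; have cts := calc_charts HDt; rewrite /mean_ext.
have sE j := smooth_Et framet j Uy; have sN := normal_smooth Uy.
by sm.
Qed.

Lemma mean_curvE q : W q -> mean_curv iota Dt E N q = mean_ext (iota q).
Proof.
move=> Wq; rewrite /mean_curv /mean_ext; congr (_ * _); apply: eq_bigr => i _.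
exact: (shape_second_form Wq (lifts_E ad i Wq) (lifts_E ad i Wq)).
Qed.

Context {p : M}.
Hypothesis Wp : W p.
Let Up : U (iota p) := ad_WU ad Wp.
Local Notation x := (iota p).
Local Notation H := (mean_curv iota Dt E N).
Let Ht : vfield Mt := fun y => mean_ext y *: N y.
Let sN : smooth_field N x := normal_smooth Up.
Let lE i := lifts_E ad i Wp.
Let sE i : smooth_field (Et i) x := smooth_Et framet i Up.

Lemma extends_mean : extends iota (mean_curv_vec iota Dt E) Ht p.
Proof.
have [sM eM] := extends_tr_II ad Wp.
split; first by apply: (fieldZ HDt) => //; exact: smooth_mean_ext.
have nW := near_in openW Wp (fun _ => id).
apply: filterS2 eM nW => r <- Wr; rewrite /Ht /mean_ext /tr_II.
under [in RHS]eq_bigr do rewrite nprojE.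
by rewrite -scaler_suml scalerA.
Qed.

Lemma app_mean A X : lifts iota A X p -> X x mean_ext = A p H.
Proof.
move=> lX; have sm0 := smooth_mean_ext Up.
rewrite (app_lifts lX) //; apply: (app_eq HD).
- exact: lifts_smooth0 lX.
- exact: (emb_smooth (ad_emb ad)).
- by apply: (near_in openW Wp) => r Wr; rewrite mean_curvE.
Qed.

Section Field.
Context {v : vfield M} {vt : vfield Mt}.
Hypothesis lv : lifts iota v vt p.
Let sv : smooth_field vt x := lifts_smooth lv.
Hypothesis n_gt0 : (0 < n)%N.

Lemma conn_mean : Dt vt Ht x = (v p H : R) *: N x + H p *: Dt vt N x.
Proof.
rewrite (connZr HDt (f := mean_ext)) //; last exact: smooth_mean_ext.
by rewrite (app_mean lv) (mean_curvE Wp).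
Qed.

Lemma lie_mean : n%:R *: lie Ht vt x =
  (n%:R * H p) *: lie N vt x - (n%:R * v p H) *: N x.
Proof.
have sm0 := smooth_mean_ext Up.
have sH : smooth_field Ht x by apply: (fieldZ HDt).
rewrite -!(conn_torsion HDt) // conn_mean.
rewrite (connZl HDt (f := mean_ext)) // -(mean_curvE Wp).
rewrite -!scalerA -scalerBr; congr (_ *: _); rewrite scalerBr.
vring.
Qed.

(** In Ric(v, N) the direction N contributes nothing, by skew symmetry, and the
    others give the opposite of the normal part of the curvature terms. *)
Lemma ric_op_normal :
  \sum_j npart iota p (curv Dt (Et j) vt (Et j) x) + npart iota p (ric_op Dt F vt x) = 0.
Proof.
have tE j := tangent_Et framet j Up; have tN := normal_tangent Up.
rewrite (npartE ad Wp (tangent_ric_op ad Wp)) nprojE.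
have -> : metric x (ric_op Dt F vt x) (N x) = ric Dt F vt N x.
  exact: (metric_frame_sum HDt framet (fun a => ric Dt F vt (F a) x) (inr ord0) Up).
have eN j : npart iota p (curv Dt (Et j) vt (Et j) x) =
    curv4 Dt (Et j) vt (Et j) N x *: N x.
  by rewrite (npartE ad Wp) ?nprojE //; sm.
rewrite (eq_bigr _ (fun j _ => eN j)) -scaler_suml -scalerDl /ric big_sumType /=.
rewrite big_ord1.
have -> : curv4 Dt N vt N N x = 0.
  have := curv_skew HDt sN sv sN sN.
  by move=> /eqP; rewrite -addr_eq0 -mulr2n mulrn_eq0 /= => /eqP.
rewrite addr0 -big_split /= big1 ?scale0r // => j _.
by rewrite {1}/curv4 (curv_skew HDt) // addNr.
Qed.

(** As N has constant length, differentiating the scalar second fundamental form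
    amounts to differentiating the normal valued one. *)
Lemma div_sffE : div_sff iota Dt D E N v p *: N x = tr_nablaB_II iota Dt D E v p.
Proof.
have tN := normal_tangent Up.
have tD X Y : smooth_field X x -> smooth_field Y x -> tangent x (Dt X Y x).
  by move=> sX sY; sm.
have metN w : tangent x w -> metric x (N x) (np x w) = metric x w (N x).
  move=> tw; rewrite (metricC HDt) //; last exact: (tangent_nproj framet).
  exact: (metric_nproj_N HDt framet Up ord0).
rewrite (tr_nablaBE ad Wp lv) /div_sff scaler_suml; apply: eq_bigr => i _.
have sI : smooth_field (fun y => np y (Dt (Et i) vt y)) x by apply: (smooth_II ad Wp).
have sT : smooth_field (fun y => tp y (Dt (Et i) vt y)) x by apply: (smooth_TT ad Wp).
have sTE : smooth_field (fun y => tp y (Dt (Et i) (Et i) y)) x by apply: (smooth_TT ad Wp).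
rewrite !nprojE -!scalerBl; congr (_ *: _); rewrite /nabla2 /sff.
rewrite (second_formE ad Wp (lifts_conn ad Wp (lE i) (lE i)) lv).
rewrite (second_formE ad Wp (lE i) (lifts_conn ad Wp (lE i) lv)).
rewrite !metN; [|exact: tD|exact: tD]; congr (_ - _ - _).
have sf : smooth (fun y => metric y (N y) (np y (Dt (Et i) vt y))) x by sm.
rewrite -(app_eq HD (f := (fun y => metric y (N y) (np y (Dt (Et i) vt y))) \o iota)); first last.
- have nW := near_in openW Wp (fun _ => id).
  apply: filterS3 nW (lifts_near ad (lE i)) (lifts_near ad lv) => r Wr l1 l2.
  by rewrite /= (second_formE ad Wr l1 l2).
- exact: (emb_smooth (ad_emb ad)).
- exact: lifts_smooth0 (lE i).
rewrite -(app_lifts (lE i)) // (app_metric HDt) //.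
rewrite nprojE (metricZr HDt) //; last exact: tD.
rewrite metric_conn_NN // mulr0 add0r.
by rewrite (metricC HDt) //; exact: tD.
Qed.

Lemma mean_codazzi :
  (n%:R * v p H) *: N x =
  div_sff iota Dt D E N v p *: N x + npart iota p (ric_op Dt F vt x).
Proof.
have tN := normal_tangent Up.
have tD X Y : smooth_field X x -> smooth_field Y x -> tangent x (Dt X Y x).
  by move=> sX sY; sm.
rewrite div_sffE (tr_nablaB_codazzi ad Wp lv n_gt0 extends_mean) conn_mean.
have -> : np x ((v p H : R) *: N x + H p *: Dt vt N x) = (v p H : R) *: N x.
  rewrite (nprojD HDt framet Up); [|sm|by apply: tangentZ; exact: tD].
  rewrite !(nprojZ HDt framet Up) //; last exact: tD.
  rewrite (nproj_N framet Up ord0) nprojE metric_conn_NN //.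
  by rewrite scale0r scaler0 addr0.
have eN j : npart iota p (curv Dt (Et j) vt (Et j) x) = np x (curv Dt (Et j) vt (Et j) x).
  by rewrite (npartE ad Wp) //; sm.
by rewrite -(eq_bigr _ (fun j _ => eN j)) -addrA ric_op_normal addr0 scalerA.
Qed.

(** The E_i are eigenvectors, so only diagonal entries of D v contribute. *)
Lemma shape_term (kappa : 'I_n -> R) :
  (forall i, shape_op iota Dt N (E i) p = kappa i *: E i p) ->
  \sum_j second_form iota Dt (E j) (D (E j) v) p =
  (\sum_i kappa i * metric p (D (E i) v p) (E i p)) *: N x.
Proof.
move=> eig; rewrite scaler_suml; apply: eq_bigr => j _.
have lD := lifts_conn ad Wp (lE j) lv.
have tE := field_tangent (lifts_smooth0 (lE j)).
have tD := field_tangent (lifts_smooth0 lD).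
rewrite (second_formE ad Wp (lE j) lD) nprojE; congr (_ *: _).
rewrite -(shape_second_form Wp (lE j) lD) eig (metricZl HD) //.
by rewrite (metricC HD).
Qed.

Local Notation NN := (fun q : M => tpart iota q (Dt N N (iota q))).

(** The field D_N N is tangent to M and lifts the field NN of M, so that the
    Gauss formula splits the derivative of v along it. *)
Lemma conn_normal_normal :
  Dt (Dt N N) vt x = push iota p (D NN v p) + sff iota Dt N NN v p *: N x.
Proof.
have tN := normal_tangent Up.
have sNN : smooth_field (Dt N N) x by sm.
pose T y := tp y (Dt N N y).
have sT : smooth_field T x by apply: (smooth_tproj HDt framet).
have lN : lifts iota NN T p.
  have nW := near_in openW Wp (fun _ => id).
  have nT : \forall r \near p, smooth_field (Dt N N) (iota r).
    by apply: (near_push ad); exact: field_near.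
  split; last first.
    split=> //; apply: filterS2 nW nT => r Wr sr.
    by rewrite /pushf (push_tpart ad Wr) //; exact: field_tangent.
  apply: (@field_germ _ _ _ _ HD (fun r =>
      \sum_i metric (iota r) (Dt N N (iota r)) (Et i (iota r)) *: E i r)).
    apply: (field_sum HD) => i; apply: (fieldZ HD); last exact: lifts_smooth0 (lE i).
    apply: (emb_smooth (ad_emb ad) (f := fun y => metric y (Dt N N y) (Et i y))).
    by sm.
  apply: filterS2 nW nT => r Wr sr.
  by rewrite (tpartE ad Wr) //; exact: field_tangent.
have TE : Dt N N x = T x.
  rewrite -[LHS](proj_split HDt framet Up); last by sm.
  by rewrite [np _ _]nprojE metric_conn_NN // scale0r addr0.
rewrite (conn_pointwise HDt framet openU Up sNN sT sv TE).
have tT : tangent x (Dt T vt x) by sm.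
rewrite -[LHS](proj_split HDt framet Up) // (gauss_formula ad Wp lN lv).
congr (_ + _); rewrite /sff (second_formE ad Wp lN lv).
rewrite (metricC HDt) //; last exact: (tangent_nproj framet).
by rewrite (metric_nproj_N HDt framet Up ord0) // nprojE.
Qed.

(** Here the two divergences enter: their difference is g(D_N v, N), which is
    therefore 0 and is also the normal component of [N, v]. *)
Lemma lie_normal_tangential :
  divergence D E v p = 0 -> divergence Dt F vt x = 0 ->
  push iota p (tpart iota p (lie N vt x)) = lie N vt x.
Proof.
move=> div0 divt0; have tN := normal_tangent Up.
have tl : tangent x (lie N vt x) by sm.
rewrite (push_tpart ad Wp) // -[RHS](proj_split HDt framet Up) // nprojE.
suff -> : metric x (lie N vt x) (N x) = 0 by rewrite scale0r addr0.
rewrite -(conn_torsion HDt) // (metricBl HDt); try sm.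
rewrite metric_conn_NN // subr0.
move: divt0; rewrite /divergence big_sumType /= big_ord1 => <-.
rewrite -[LHS]add0r -{1}div0; congr (_ + _); apply: eq_bigr => i _.
have tE := field_tangent (lifts_smooth0 (lE i)).
have lD := lifts_conn ad Wp (lE i) lv.
have tD : tangent x (Dt (Et i) vt x) by sm.
rewrite -(metric_tproj_Et HDt framet Up) // -(gauss_formula ad Wp (lE i) lv).
rewrite (ad_ext ad) // (metric_push ad) //.
exact: field_tangent (lifts_smooth0 lD).
Qed.

(** The extension H N turns [H N, v] into H [N, v] - v(H) N, and the normal
    curvature terms cancel. *)
Theorem hypersurface_laplacian (kappa : 'I_n -> R) :
  divergence D E v p = 0 -> divergence Dt F vt x = 0 ->
  (forall i, shape_op iota Dt N (E i) p = kappa i *: E i p) ->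
  bochner Dt F vt x - ric_op Dt F vt x =
    push iota p (bochner D E v p - ric_op D E v p)
    + (n%:R * H p) *: push iota p (tpart iota p (lie N vt x))
    - Dt N (Dt N vt) x + push iota p (D NN v p)
    - \sum_j curv4 Dt N (Et j) vt N x *: Et j x
    + (- (2 * (\sum_i kappa i * metric p (D (E i) v p) (E i p)) + n%:R * v p H) *: N x
       + sff iota Dt N NN v p *: N x).
Proof.
move=> div0 divt0 eig.
rewrite (laplacian_lie ad Wp lv n_gt0 extends_mean) !big_ord1.
rewrite lie_mean (shape_term eig) conn_normal_normal lie_normal_tangential //.
have e : \sum_j npart iota p (curv Dt (Et j) vt (Et j) x) = - npart iota p (ric_op Dt F vt x).
  by apply/eqP; rewrite -addr_eq0 ric_op_normal.
rewrite e; set a1 := push _ _ _; set a2 := lie _ _ _; set a3 := Dt N _ _; set a4 := push _ _ _.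
set a5 := \sum_(j < n) _ *: _; set a6 := npart _ _ _; set c1 := \sum_(i < n) _.
set c2 := v p H; set c3 := sff _ _ _ _ _ _; set c4 := H p; set a7 := N x.
clearbody a1 a2 a3 a4 a5 a6 a7 c1 c2 c3 c4.
vring.
Qed.

Theorem normal_term (kappa : 'I_n -> R) :
  - (2 * (\sum_i kappa i * metric p (D (E i) v p) (E i p)) + n%:R * v p H) *: N x
    + sff iota Dt N NN v p *: N x =
  - (2 * (\sum_i kappa i * metric p (D (E i) v p) (E i p))
     + div_sff iota Dt D E N v p) *: N x
    - npart iota p (ric_op Dt F vt x) + sff iota Dt N NN v p *: N x.
Proof.
congr (_ + _); rewrite !scaleNr !scalerDl -!opprD; congr (- _).
by rewrite -addrA -mean_codazzi.
Qed.

End Field.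
End Hypersurface.

(** * Flatness of Euclidean space *)

Section Euclidean.
Context {R : realType} {n k : nat}.
Local Notation Mt := (euclidean R (n + k)).
Local Notation xi i := (fun y : Mt => (y : 'rV[R]_(n + k)) ord0 i : R).

Lemma euclidean_charts m : open_charts (euclidean R m).
Proof.
split=> c ->; rewrite /=.
  by split; [exact: openT | rewrite image_id; exact: openT].
by move=> p _; split=> //; exact: cvg_id.
Qed.

Lemma smooth_coord m i (y : euclidean R m) :
  smooth (fun z : euclidean R m => (z : 'rV[R]_m) ord0 i) y.
Proof.
apply/smoothP; exists setT; split=> //; first exact: openT.
by move=> c -> l; exact: diff_upto_coord.
Qed.

Lemma euclidean_calculus m
    (D : vfield (euclidean R m) -> vfield (euclidean R m) -> vfield (euclidean R m)) :
  levi_civita D -> calculus D.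
Proof.
move=> lcD; have cts := euclidean_charts m; split=> //.
- move=> p a u v w _ _ _; rewrite /= mulr_sumr -big_split /=.
  apply: eq_bigr => i _; rewrite mulrA -mulrDl; congr (_ * _).
- by move=> p u w _ _; apply: eq_bigr => i _; rewrite mulrC.
- move=> p X Y sX sY; rewrite /=; apply: (smooth_sum cts) => i.
  by apply: (smoothM cts); apply: smooth_app => //; exact: smooth_coord.
Qed.

Context {D : vfield Mt -> vfield Mt -> vfield Mt}.
Hypothesis lcD : levi_civita D.
Let HD := euclidean_calculus lcD.
Context {F : 'I_n + 'I_k -> vfield Mt} {U : set Mt}.
Hypothesis openU : open U.
Hypothesis frame : forall y, U y -> frame_at F y.
Implicit Types (X Y Z : vfield Mt) (y : Mt).

Lemma euclidean_metricE y (u w : vec Mt) :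
  metric y u w = \sum_i (u (xi i) : R) * w (xi i).
Proof. by []. Qed.

(** The coordinates of the frame vectors form a square matrix with orthonormal
    rows, hence with orthonormal columns: this replaces the existence of
    coordinate fields. *)
Lemma tangent_coord_exists y (c : 'I_(n + k) -> R) : U y ->
  exists2 w : vec Mt, tangent y w & forall i, w (xi i) = c i.
Proof.
move=> Uy; have tF a : tangent y (F a y) by apply: (frame_tangent frame).
have [_ on _] := frame Uy.
(* The row index is split to match the index type of the frame. *)
pose A : 'M[R]_(n + k) := \matrix_(r, i) F (fintype.split r) y (xi i).
have AA : A *m A^T = 1%:M.
  apply/matrixP => r s; rewrite !mxE.
  rewrite -(inj_eq (can_inj (@splitK n k))) -on euclidean_metricE.
  by apply: eq_bigr => i _; rewrite !mxE.
have {}AA := mulmx1C AA.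
exists (\sum_r (\sum_j c j * A r j) *: F (fintype.split r) y); first by sm.
move=> i; rewrite fct_sumE.
transitivity (\sum_r \sum_j c j * (A r j * A r i)).
  apply: eq_bigr => r _; rewrite fctE /GRing.scale /= mulr_suml.
  by apply: eq_bigr => j _; rewrite -mulrA [A r i]mxE.
rewrite exchange_big /= (bigD1 i) //= -mulr_sumr.
have e j : \sum_r A r j * A r i = (j == i)%:R.
  by have /matrixP/(_ j i) := AA; rewrite !mxE => <-; apply: eq_bigr => r _; rewrite !mxE.
rewrite e eqxx mulr1 big1 ?addr0 // => j ji.
by rewrite -mulr_sumr e (negbTE ji) mulr0.
Qed.

Lemma euclidean_app_metric X Y Z y : smooth_field X y -> smooth_field Y y ->
  smooth_field Z y -> X y (fun z => metric z (Y z) (Z z)) =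
    \sum_i ((Y y (xi i) : R) * X y (fun z => Z z (xi i))
      + (Z y (xi i) : R) * X y (fun z => Y z (xi i))) :> R.
Proof.
move=> sX sY sZ; have cts := calc_charts HD; have tX := field_tangent sX.
have sc V i : smooth_field V y -> smooth (fun z => V z (xi i)) y.
  by move=> sV; apply: smooth_app => //; exact: smooth_coord.
rewrite /= (tangent_sum_fun cts _ tX); last by move=> i; apply: smoothM => //; exact: sc.
by apply: eq_bigr => i _; rewrite (tangent_leibniz tX) //; exact: sc.
Qed.

(** The vector with these coordinates satisfies the Koszul formula. *)
Lemma euclidean_conn X Y y i : U y -> smooth_field X y -> smooth_field Y y ->
  D X Y y (xi i) = X y (fun z => Y z (xi i)).
Proof.
move=> Uy sX sY.
have [w tw wE] := tangent_coord_exists (fun i => X y (fun z => Y z (xi i))) Uy.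
rewrite -wE; suff -> : D X Y y = w by []; apply: (frame_eq HD frame Uy) => //; first by sm.
move=> a; have sF : smooth_field (F a) y by apply: (frame_smooth frame).
apply: (@pmulrnI _ 2) => //; rewrite (koszul HD) //.
rewrite !euclidean_app_metric // !euclidean_metricE.
rewrite -!big_split /= -!sumrB -!big_split /= -!sumrB -!big_split /= -sumrMnl.
apply: eq_bigr => j _; rewrite !lieE; try exact: smooth_coord.
rewrite wE; ring.
Qed.

(** In coordinates the curvature is X Y - Y X - [X, Y] applied to the
    coordinates of Z. *)
Lemma euclidean_flat X Y Z y : U y -> smooth_field X y -> smooth_field Y y ->
  smooth_field Z y -> curv D X Y Z y = 0.
Proof.
move=> Uy sX sY sZ.
have tF a : tangent y (F a y) by apply: (frame_tangent frame).
have tR : tangent y (curv D X Y Z y) by sm.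
apply: (frame_eq HD frame Uy) => //; first exact: tangent0.
move=> a; rewrite !euclidean_metricE; apply: eq_bigr => i _; congr (_ * _).
have nU := near_in openU Uy (fun _ => id).
have sc V : smooth_field V y -> smooth (fun z => V z (xi i)) y.
  by move=> sV; apply: smooth_app => //; exact: smooth_coord.
have e V V' : smooth_field V y -> smooth_field V' y ->
    D V (D V' Z) y (xi i) = V y (fun z => V' z (fun z' => Z z' (xi i))).
  move=> sV sV'; rewrite euclidean_conn //; last by sm.
  apply: (app_eq HD sV); first by apply: sc; sm.
  apply: filterS3 nU (field_near sV') (field_near sZ) => z Uz sz sz'.
  exact: euclidean_conn.
rewrite /curv !fctE !e // euclidean_conn //; last by sm.
by rewrite lieE ?subrr //; exact: sc.
Qed.

End Euclidean.

(** * The comparison of the Laplacians *)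

Lemma riemannian_calculus (R : realType) (m : nat) (M : riem R m)
    (D : vfield M -> vfield M -> vfield M) :
  smooth_manifold M -> riemannian_metric M -> levi_civita D -> calculus D.
Proof. by move=> [_ _ _ op ho _] [li sy _ sm0] lc; split. Qed.

Section Setting.
Context {R : realType} {n k : nat} {Mt : riem R (n + k)} {M : riem R n}.
Context {iota : M -> Mt}.
Context {Dt : vfield Mt -> vfield Mt -> vfield Mt}.
Context {D : vfield M -> vfield M -> vfield M} {p : M}.
Context {E : 'I_n -> vfield M} {Et : 'I_n -> vfield Mt} {N : 'I_k -> vfield Mt}.
Context {v : vfield M} {vt : vfield Mt}.
Hypothesis HDt : calculus Dt.
Hypothesis st : setting iota Dt D p E Et N v vt.
Local Notation F := (join_frame Et N).

Lemma setting_calculus : calculus D.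
Proof. exact: riemannian_calculus (set_manifold st) (set_metric st) (set_lc st). Qed.

(** All conditions hold near p or near iota p; continuity of iota makes the
    neighbourhoods compatible. *)
Lemma setting_adapted : exists W U,
  [/\ @adapted R n k (n + k) Mt M iota Dt D E Et N W U, W p,
      forall y, U y -> smooth_field vt y /\ divergence Dt F vt y = 0 &
      forall q, W q -> divergence D E v q = 0].
Proof.
have HD := setting_calculus.
have fr := on_frame_near (set_ambient_frame st).
have [svt _] := set_field_ext st.
have : \forall y \near iota p,
    [/\ frame_at F y, smooth_field vt y & divergence Dt F vt y = 0].
  by apply: filterS3 fr (field_near svt) (set_ambient_div st) => y.
move=> /nearP[U [oU Up UP]].
have nU : \forall q \near p, U (iota q).
  have : \forall y \near iota p, U y by exact: (near_in oU Up (fun _ => id)).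
  exact: (emb_continuous (set_embedding st)).
have nE : \forall q \near p, forall i, Et i (iota q) = push iota q (E i q).
  by apply: filter_forall => i; have [_] := set_frame_ext st i.
have : \forall q \near p, [/\ U (iota q), forall i, Et i (iota q) = push iota q (E i q),
    frame_at E q & divergence D E v q = 0].
  have fE := on_frame_near (set_frame st).
  near=> q; split; near: q => //; exact: set_div st.
move=> /nearP[W [oW Wp WP]].
exists W, U; split=> //.
- split=> //.
  + exact: set_embedding st.
  + by move=> q /WP[].
  + by move=> y /UP[].
  + by move=> q /WP[].
  + by move=> q i /WP[].
- by move=> y /UP[].
- by move=> q /WP[].
Unshelve. all: by end_near. Qed.

Lemma setting_lifts : lifts iota v vt p.
Proof. by split; [exact: set_field st p|exact: set_field_ext st]. Qed.

Lemma setting_weitzenbock :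
  (\forall y \near iota p,
     - 2 *: div_def Dt F vt y = bochner Dt F vt y - ric_op Dt F vt y) /\
  (\forall q \near p,
     - 2 *: div_def D E v q = bochner D E v q - ric_op D E v q).
Proof.
have [W [U [ad Wp Udiv Wdiv]]] := setting_adapted.
have HD := setting_calculus; have Up := ad_WU ad Wp.
split.
  apply: (near_in (ad_openU ad) Up) => y Uy; have [sv _] := Udiv y Uy.
  by apply: (weitzenbock HDt (ad_framet ad) (ad_openU ad) Uy sv) => z /Udiv[].
apply: (near_in (ad_openW ad) Wp) => q Wq.
by apply: (weitzenbock HD (ad_frame ad) (ad_openW ad) Wq (set_field st q)).
Qed.

End Setting.

Section EuclideanSetting.
Context {R : realType} {n k : nat} {M : riem R n}.
Local Notation Mt := (euclidean R (n + k)).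
Context {iota : M -> Mt}.
Context {Dt : vfield Mt -> vfield Mt -> vfield Mt}.
Context {D : vfield M -> vfield M -> vfield M} {p : M}.
Context {E : 'I_n -> vfield M} {Et : 'I_n -> vfield Mt} {N : 'I_k -> vfield Mt}.
Context {v : vfield M} {vt : vfield Mt}.
Hypothesis st : setting iota Dt D p E Et N v vt.
Local Notation F := (join_frame Et N).
Let HDt := euclidean_calculus (set_ambient_lc st).

Lemma euclidean_curv0 X Y Z : smooth_field X (iota p) -> smooth_field Y (iota p) ->
  smooth_field Z (iota p) -> curv Dt X Y Z (iota p) = 0.
Proof.
have [W [U [ad Wp _ _]]] := setting_adapted HDt st.
exact: (euclidean_flat (set_ambient_lc st) (ad_openU ad) (ad_framet ad) (ad_WU ad Wp)).
Qed.

Lemma setting_smooth : (forall a, smooth_field (F a) (iota p)) /\ smooth_field vt (iota p).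
Proof. by split; [case: (set_ambient_frame st)|case: (set_field_ext st)]. Qed.

Lemma euclidean_curv4 X Y Z V : smooth_field X (iota p) -> smooth_field Y (iota p) ->
  smooth_field Z (iota p) -> smooth_field V (iota p) -> curv4 Dt X Y Z V (iota p) = 0.
Proof.
move=> sX sY sZ sV; rewrite /curv4 euclidean_curv0 // (metric0l HDt) //.
exact: field_tangent.
Qed.

Lemma euclidean_ric_op : ric_op Dt F vt (iota p) = 0.
Proof.
have [sF sv] := setting_smooth.
rewrite /ric_op big1 // => a _; rewrite /ric big1 ?scale0r // => b _.
exact: euclidean_curv4.
Qed.

Lemma npart0 : npart iota p (0 : vec Mt) = 0.
Proof.
have [W [U [ad Wp _ _]]] := setting_adapted HDt st.
by rewrite (npartE ad Wp tangent0) (nproj0 HDt (ad_framet ad) (ad_WU ad Wp)).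
Qed.

End EuclideanSetting.

Unset Implicit Arguments.
Theorem corollary1p18 (R : realType) (n k : nat) (hn : (2 <= n)%N)
    (hk : (1 <= k)%N) :
  (* general codimension, general ambient manifold *)
  (forall (Mt : riem R (n + k)) (M : riem R n) (iota : M -> Mt)
     (Dt : vfield Mt -> vfield Mt -> vfield Mt)
     (D : vfield M -> vfield M -> vfield M) (p : M)
     (E : 'I_n -> vfield M) (Et : 'I_n -> vfield Mt) (N : 'I_k -> vfield Mt)
     (v : vfield M) (vt : vfield Mt),
     smooth_manifold Mt -> riemannian_metric Mt ->
     setting iota Dt D p E Et N v vt ->
     let F := join_frame Et N in
     [/\ \forall x \near iota p,
           - 2 *: div_def Dt F vt x = bochner Dt F vt x - ric_op Dt F vt x,
         \forall q \near p,
           - 2 *: div_def D E v q = bochner D E v q - ric_op D E v q &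
         forall Ht : vfield Mt,
           extends iota (mean_curv_vec iota Dt E) Ht p ->
           bochner Dt F vt (iota p) - ric_op Dt F vt (iota p) =
             push iota p (bochner D E v p - ric_op D E v p)
             + n%:R *: lie Ht vt (iota p)
             - \sum_l Dt (N l) (Dt (N l) vt) (iota p)
             + \sum_l Dt (Dt (N l) (N l)) vt (iota p)
             - \sum_l \sum_j
                 curv4 Dt (N l) (Et j) vt (N l) (iota p) *: Et j (iota p)
             - 2 *: \sum_j second_form iota Dt (E j) (D (E j) v) p
             - \sum_j npart iota p (curv Dt (Et j) vt (Et j) (iota p))
             - npart iota p (ric_op Dt F vt (iota p))
           /\
           bochner Dt F vt (iota p) - ric_op Dt F vt (iota p) =
             push iota p (bochner D E v p - ric_op D E v p)
             + n%:R *: push iota p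
                 (weingarten iota Dt (mean_curv_vec iota Dt E) v p)
             + n%:R *: Dt Ht vt (iota p)
             - \sum_l Dt (N l) (Dt (N l) vt) (iota p)
             + \sum_l Dt (Dt (N l) (N l)) vt (iota p)
             - \sum_l \sum_j
                 curv4 Dt (N l) (Et j) vt (N l) (iota p) *: Et j (iota p)
             - tr_nablaB_II iota Dt D E v p
             - 2 *: \sum_j second_form iota Dt (E j) (D (E j) v) p
             - npart iota p (ric_op Dt F vt (iota p))])
  /\
  (* general codimension, Euclidean ambient space *)
  (forall (M : riem R n) (iota : M -> euclidean R (n + k))
     (Dt : vfield (euclidean R (n + k)) -> vfield (euclidean R (n + k)) ->
           vfield (euclidean R (n + k)))
     (D : vfield M -> vfield M -> vfield M) (p : M)
     (E : 'I_n -> vfield M) (Et : 'I_n -> vfield (euclidean R (n + k)))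
     (N : 'I_k -> vfield (euclidean R (n + k)))
     (v : vfield M) (vt Ht : vfield (euclidean R (n + k))),
     setting iota Dt D p E Et N v vt ->
     extends iota (mean_curv_vec iota Dt E) Ht p ->
     let F := join_frame Et N in
     bochner Dt F vt (iota p) =
       push iota p (bochner D E v p - ric_op D E v p)
       + n%:R *: lie Ht vt (iota p)
       - \sum_l Dt (N l) (Dt (N l) vt) (iota p)
       + \sum_l Dt (Dt (N l) (N l)) vt (iota p)
       - 2 *: \sum_j second_form iota Dt (E j) (D (E j) v) p
     /\
     bochner Dt F vt (iota p) =
       push iota p (bochner D E v p - ric_op D E v p)
       + n%:R *: push iota p
           (weingarten iota Dt (mean_curv_vec iota Dt E) v p)
       + n%:R *: Dt Ht vt (iota p)
       - \sum_l Dt (N l) (Dt (N l) vt) (iota p)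
       + \sum_l Dt (Dt (N l) (N l)) vt (iota p)
       - tr_nablaB_II iota Dt D E v p
       - 2 *: \sum_j second_form iota Dt (E j) (D (E j) v) p)
  /\
  (* hypersurfaces, general ambient manifold *)
  (forall (Mt : riem R (n + 1)) (M : riem R n) (iota : M -> Mt)
     (Dt : vfield Mt -> vfield Mt -> vfield Mt)
     (D : vfield M -> vfield M -> vfield M) (p : M)
     (E : 'I_n -> vfield M) (Et : 'I_n -> vfield Mt) (N : vfield Mt)
     (v : vfield M) (vt : vfield Mt) (kappa : 'I_n -> R),
     smooth_manifold Mt -> riemannian_metric Mt ->
     setting iota Dt D p E Et (fun _ : 'I_1 => N) v vt ->
     (forall i, shape_op iota Dt N (E i) p = kappa i *: E i p) ->
     let F := join_frame Et (fun _ : 'I_1 => N) in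
     let H := mean_curv iota Dt E N in
     let NN : vfield M := fun q => tpart iota q (Dt N N (iota q)) in
     let E2 : vec Mt :=
       - \sum_j curv4 Dt N (Et j) vt N (iota p) *: Et j (iota p) in
     let N4 : vec Mt :=
       - (2 * (\sum_i kappa i * metric p (D (E i) v p) (E i p))
          + n%:R * v p H) *: N (iota p)
       + sff iota Dt N NN v p *: N (iota p) in
     bochner Dt F vt (iota p) - ric_op Dt F vt (iota p) =
       push iota p (bochner D E v p - ric_op D E v p)
       + (n%:R * H p) *: push iota p (tpart iota p (lie N vt (iota p)))
       - Dt N (Dt N vt) (iota p)
       + push iota p (D NN v p)
       + E2 + N4
     /\
     N4 = - (2 * (\sum_i kappa i * metric p (D (E i) v p) (E i p))
             + div_sff iota Dt D E N v p) *: N (iota p)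
          - npart iota p (ric_op Dt F vt (iota p))
          + sff iota Dt N NN v p *: N (iota p))
  /\
  (* hypersurfaces, Euclidean ambient space *)
  (forall (M : riem R n) (iota : M -> euclidean R (n + 1))
     (Dt : vfield (euclidean R (n + 1)) -> vfield (euclidean R (n + 1)) ->
           vfield (euclidean R (n + 1)))
     (D : vfield M -> vfield M -> vfield M) (p : M)
     (E : 'I_n -> vfield M) (Et : 'I_n -> vfield (euclidean R (n + 1)))
     (N : vfield (euclidean R (n + 1)))
     (v : vfield M) (vt : vfield (euclidean R (n + 1))) (kappa : 'I_n -> R),
     setting iota Dt D p E Et (fun _ : 'I_1 => N) v vt ->
     (forall i, shape_op iota Dt N (E i) p = kappa i *: E i p) ->
     let F := join_frame Et (fun _ : 'I_1 => N) in
     let H := mean_curv iota Dt E N in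
     let NN : vfield M := fun q => tpart iota q (Dt N N (iota q)) in
     let N4 : vec (euclidean R (n + 1)) :=
       - (2 * (\sum_i kappa i * metric p (D (E i) v p) (E i p))
          + n%:R * v p H) *: N (iota p)
       + sff iota Dt N NN v p *: N (iota p) in
     bochner Dt F vt (iota p) =
       push iota p (bochner D E v p - ric_op D E v p)
       + (n%:R * H p) *: push iota p (tpart iota p (lie N vt (iota p)))
       - Dt N (Dt N vt) (iota p)
       + push iota p (D NN v p)
       + N4
     /\
     N4 = - (2 * (\sum_i kappa i * metric p (D (E i) v p) (E i p))
             + div_sff iota Dt D E N v p) *: N (iota p)
          - npart iota p (ric_op Dt F vt (iota p))
          + sff iota Dt N NN v p *: N (iota p)).
Proof.
have n_gt0 : (0 < n)%N by apply: leq_trans hn.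
split; last split; last split.
- move=> Mt M iota Dt D p E Et N v vt mf rm st F.
  have HDt := riemannian_calculus mf rm (set_ambient_lc st).
  have [w1 w2] := setting_weitzenbock HDt st; split=> // Ht eH.
  have [W [U [ad Wp _ _]]] := setting_adapted HDt st; have lv := setting_lifts st.
  split; first exact: (laplacian_lie ad Wp lv n_gt0 eH).
  exact: (laplacian_weingarten ad Wp lv n_gt0 eH).
- move=> M iota Dt D p E Et N v vt Ht st eH F.
  have HDt := euclidean_calculus (set_ambient_lc st).
  have [W [U [ad Wp _ _]]] := setting_adapted HDt st; have lv := setting_lifts st.
  have [sF sv] := setting_smooth st.
  have sE j : smooth_field (Et j) (iota p) := sF (inl j).
  have sN l : smooth_field (N l) (iota p) := sF (inr l).
  have e1 := laplacian_lie ad Wp lv n_gt0 eH.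
  have e2 := laplacian_weingarten ad Wp lv n_gt0 eH.
  have R0 : \sum_l \sum_j curv4 Dt (N l) (Et j) vt (N l) (iota p) *: Et j (iota p) = 0.
    rewrite big1 // => l _; rewrite big1 // => j _.
    by rewrite (euclidean_curv4 st) ?scale0r.
  have C0 : \sum_j npart iota p (curv Dt (Et j) vt (Et j) (iota p)) = 0.
    by rewrite big1 // => j _; rewrite (euclidean_curv0 st) // (npart0 st).
  move: e1 e2; rewrite (euclidean_ric_op st) (npart0 st) R0 C0 !subr0.
  by split.
- move=> Mt M iota Dt D p E Et N v vt kappa mf rm st eig F H NN E2 N4.
  have HDt := riemannian_calculus mf rm (set_ambient_lc st).
  have [W [U [ad Wp Ud Wd]]] := setting_adapted HDt st; have lv := setting_lifts st.
  have [_ divt0] := Ud _ (ad_WU ad Wp).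
  split; last exact: (normal_term ad Wp lv n_gt0).
  exact: (hypersurface_laplacian ad Wp lv n_gt0 (Wd p Wp) divt0 eig).
- move=> M iota Dt D p E Et N v vt kappa st eig F H NN N4.
  have HDt := euclidean_calculus (set_ambient_lc st).
  have [W [U [ad Wp Ud Wd]]] := setting_adapted HDt st; have lv := setting_lifts st.
  have [_ divt0] := Ud _ (ad_WU ad Wp).
  have [sF sv] := setting_smooth st.
  have sE j : smooth_field (Et j) (iota p) := sF (inl j).
  have sN : smooth_field N (iota p) := sF (inr ord0).
  split; last exact: (normal_term ad Wp lv n_gt0).
  have := hypersurface_laplacian ad Wp lv n_gt0 (Wd p Wp) divt0 eig.
  have R0 : \sum_j curv4 Dt N (Et j) vt N (iota p) *: Et j (iota p) = 0.
    by rewrite big1 // => j _; rewrite (euclidean_curv4 st) ?scale0r.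
  by rewrite (euclidean_ric_op st) R0 !subr0.
Qed.
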